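(* There is a constant $C>0$ such that for every $\lambda>0$ and every $\zeta>C\sqrt{\lambda}$ there exists $c>0$, depending on $\lambda$ and $\zeta$, such that for all large enough $n$ the following holds. Consider the Activated Random Walk dynamics with sleep rate $\lambda$ on the ring $\mathbb{Z}_n=\mathbb{Z}/n\mathbb{Z}$, started from an initial configuration of active walks whose numbers at the sites of $\mathbb{Z}_n$ are i.i.d. Poisson random variables with mean $\zeta$, and let $\mathcal{T}$ be the total activity of the system. Then $$\mathbb{P}_{\mathbb{Z}_n}\big(\mathcal{T}\ge e^{cn}\big)\ge 1-e^{-cn}.$$
   Context: Activated Random Walk (ARW) dynamics with sleep rate $\lambda>0$ on $\mathbb{Z}_n=\mathbb{Z}/n\mathbb{Z}$. Let $\mathbb{N}=\{0,1,2,\dots\}$ and $\mathbb{N}_{\mathfrak{s}}=\mathbb{N}\cup\{\mathfrak{s}\}$, where $\mathfrak{s}$ represents a single sleeping walk and $n\in\mathbb{N}$ represents $n$ active walks. Conventions: $|\mathfrak{s}|=1$, $|k|=k$ for $k\in\mathbb{N}$; $\mathfrak{s}+1=2$; $k\cdot\mathfrak{s}=k$ for $k\ge 2$ and $1\cdot\mathfrak{s}=\mathfrak{s}$. The state at time $t$ is $\eta_t\in(\mathbb{N}_{\mathfrak{s}})^{\mathbb{Z}_n}$. At each site $x$ a clock rings at rate $(1+\lambda)\,|\eta_t(x)|\,\mathbf{1}_{\eta_t(x)\neq\mathfrak{s}}$. When it rings, with probability $\frac{\lambda}{1+\lambda}$ the value $\eta(x)$ is replaced by $\eta(x)\cdot\mathfrak{s}$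 (a walk tries to fall asleep, succeeding only if it is alone at $x$), and otherwise, with probability $\frac12\cdot\frac1{1+\lambda}$ for each of $y=x\pm1$ (modulo $n$), one walk jumps from $x$ to $y$: $\eta(x)$ becomes $\eta(x)-1$ and $\eta(y)$ becomes $\eta(y)+1$ (so a sleeping walk at $y$ is reactivated). No walk is ever lost. The total activity $\mathcal{T}\in[0,\infty]$ is obtained by adding, over all sites, the total time each site is occupied by active walks, counted with multiplicity: $\mathcal{T}=\sum_{x\in\mathbb{Z}_n}\int_0^\infty|\eta_t(x)|\,\mathbf{1}_{\eta_t(x)\neq\mathfrak{s}}\,dt$. *)

(* Defs.v *)
From mathcomp Require Export all_boot all_order all_algebra.
From mathcomp Require Export all_classical all_reals all_analysis measurable_realfun.

Set Implicit Arguments.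
Unset Strict Implicit.
Unset Printing Implicit Defensive.

Export Order.TTheory GRing.Theory Num.Theory.
Export numFieldNormedType.Exports.

Local Open Scope classical_set_scope.
Local Open Scope ring_scope.

(* [Some k] stands for k active walks and [None] for the symbol s, a single
   sleeping walk. *)
Definition occupation := option nat.

Notation active k := (Some k : occupation) (only parsing).
Notation sleeping := (None : occupation) (only parsing).

(* |v| 1_{v <> s} *)
Definition nactive (v : occupation) : nat := if v is Some k then k else 0%N.

Definition add_walk (v : occupation) : occupation :=
  if v is Some k then active k.+1 else active 2%N.

(* The clock of x does not ring when eta x is [active 0] or [sleeping], so the
   values of [remove_walk] and [try_sleep] there play no role. *)
Definition remove_walk (v : occupation) : occupation :=
  if v is Some k then active k.-1 else sleeping.

Definition try_sleep (v : occupation) : occupation :=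
  if v == active 1%N then sleeping else v.

(* The sites of Z_n are the elements of 'I_n; the neighbours x + 1 and x - 1
   modulo n are [ordS x] and [ord_pred x]. *)
Definition config (n : nat) := {ffun 'I_n -> occupation}.

Definition update (n : nat) (f : occupation -> occupation) (x : 'I_n)
    (eta : config n) : config n :=
  [ffun z => if z == x then f (eta z) else eta z].

Definition sleep_at (n : nat) (x : 'I_n) (eta : config n) : config n :=
  update try_sleep x eta.

Definition jump (n : nat) (x y : 'I_n) (eta : config n) : config n :=
  update add_walk y (update remove_walk x eta).

Section Rates.
Variables (R : realType) (lambda : R) (n : nat).

Definition clock_rate (eta : config n) (x : 'I_n) : R :=
  (1 + lambda) * (nactive (eta x))%:R.

Definition total_rate (eta : config n) : R := \sum_(x < n) clock_rate eta x.

(* Law of the configuration eta' following a ring at x in eta: sleep, jump to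
   x + 1, jump to x - 1.  A failed attempt to sleep leaves eta unchanged. *)
Definition ring_prob (x : 'I_n) (eta eta' : config n) : R :=
  lambda / (1 + lambda) * (eta' == sleep_at x eta)%:R +
  2^-1 * (1 + lambda)^-1 * (eta' == jump x (ordS x) eta)%:R +
  2^-1 * (1 + lambda)^-1 * (eta' == jump x (ord_pred x) eta)%:R.

(* Independent exponential clocks of rates [clock_rate eta x], x in Z_n: the
   first one to ring is the one at x with probability
   [clock_rate eta x / total_rate eta].  A configuration without active walks
   is absorbing. *)
Definition next_prob (eta eta' : config n) : R :=
  if total_rate eta == 0 then (eta' == eta)%:R
  else \sum_(x < n) clock_rate eta x / total_rate eta * ring_prob x eta eta'.

End Rates.

Section JumpProcess.
Context (R : realType) d (Omega : measurableType d) (P : probability Omega R).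
Variables (S : countType) (rate : S -> R) (p : S -> S -> R).

Definition ring_time (W : nat -> Omega -> \bar R) (k : nat) (omega : Omega) :
  \bar R := (\sum_(i < k) W i omega)%E.

(* [Y k] is the state after the k-th ring and [W k] the waiting time between
   the k-th and the (k+1)-st one.  The formula in [jump_law] says that Y is a
   Markov chain with transition probabilities p and that, given Y, the W k are
   independent and exponential of parameter [rate (Y k)]; when the rate is 0
   it forces W k = +oo almost surely. *)
Record jump_skeleton (Y : nat -> Omega -> S) (W : nat -> Omega -> \bar R) :
    Prop := {
  jump_measurable_state : forall k s, measurable [set omega | Y k omega = s];
  jump_measurable_wait : forall k, measurable_fun setT (W k);
  jump_wait_gt0 : forall k omega, (0 < W k omega)%E;
  jump_law : forall (m : nat) (s : nat -> S) (t : nat -> R),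
    (forall i, 0 <= t i) ->
    P [set omega | (forall i, (i <= m)%N -> Y i omega = s i) /\
                   (forall i, (i < m)%N -> ((t i)%:E < W i omega)%E)] =
    (P [set omega | Y 0%N omega = s 0%N] *
     (\prod_(i < m) (expR (- (rate (s i) * t i)) * p (s i) (s i.+1)))%:E)%E
}.

(* Continuous-time jump process with holding rates [rate] and jump
   probabilities p.  The last clause gives the value at every time t >= 0, so
   that no path explodes. *)
Definition jump_process (eta : R -> Omega -> S) : Prop :=
  exists (Y : nat -> Omega -> S) (W : nat -> Omega -> \bar R),
    jump_skeleton Y W /\
    forall (t : R) (omega : Omega), 0 <= t -> exists k : nat,
      (ring_time W k omega <= t%:E < ring_time W k.+1 omega)%E /\
      eta t omega = Y k omega.

End JumpProcess.

Section ARW.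
Context (R : realType) d (Omega : measurableType d) (P : probability Omega R).
Variable n : nat.

Definition arw_process (lambda : R) (eta : R -> Omega -> config n) : Prop :=
  jump_process P (@total_rate R lambda n) (@next_prob R lambda n) eta.

(* Joint mass function of i.i.d. Poisson numbers of active walks. *)
Definition iid_poisson (zeta : R) (eta0 : Omega -> config n) : Prop :=
  forall k : 'I_n -> nat,
    P [set omega | forall x, eta0 omega x = active (k x)] =
    (\prod_(x < n) poisson_pmf zeta (k x))%:E.

Definition total_activity (eta : R -> Omega -> config n) (omega : Omega) :
  \bar R :=
  (\sum_(x < n) \int[lebesgue_measure]_(t in `[0%R, +oo[)
      ((nactive (eta t omega x))%:R)%:E)%E.

End ARW.

(* Main.v *)
(* Write L for lambda.  Fix a set A of m sites, m being the number of walks, and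
   bound the probability that the walks fall asleep exactly on A.  Ignoring the
   attempts to sleep outside A only helps, and by the abelian property the
   active site to topple may then be chosen at will.  First move walks until
   each site of A holds exactly one; then topple an awake x in A whose next site
   y in A, at distance g, is asleep: x falls asleep before its walk reaches y
   with odds of about 2 L g to 1.  For suitable weights w in (0, 1), the product
   of w x over the x in A that are not asleep is a supermartingale, except when
   all of A is awake.  The weights solve 2 L g_x (1 - w x) = w x (1 - w y), a
   cyclic system whose solutions satisfy prod_A w = prod_A (2 L g_x).  Hence the
   walks need at least exponentially many topplings to stabilize on A, up to a
   probability of order prod_A (2 L g_x).

   By the arithmetic-geometric inequality this product is at most
   (2 L n / m) ^ m, and there are at most (e n / m) ^ m sets A, so the union
   bound gives (2 e L (n / m) ^ 2) ^ m, which is exponentially small once m / n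
   is a large multiple of sqrt L.  Finally the activity is at least the number
   of rings at which the total active time accumulated exceeds 1, and each ring
   before absorption has probability exp (- (1 + L)) of being so. *)

Require Import Defs.
From mathcomp Require Import zify ring lra.

Set Implicit Arguments.
Unset Strict Implicit.
Unset Printing Implicit Defensive.

Local Open Scope ring_scope.

(** * The ring and the weights *)

Definition turn (n : nat) (j : nat) (z : 'I_n) : 'I_n := iter j (@ordS n) z.

Lemma turnS n j (z : 'I_n) : turn j.+1 z = ordS (turn j z).
Proof. by []. Qed.

Lemma turnSr n j (z : 'I_n) : turn j.+1 z = turn j (ordS z).
Proof. exact: iterSr. Qed.

Lemma turnD n i j (z : 'I_n) : turn (i + j) z = turn i (turn j z).
Proof. exact: iterD. Qed.

Lemma turn_inj n j : injective (@turn n j).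
Proof. by elim: j => // j IH x y /ordS_inj /IH. Qed.

Lemma val_turn n j (z : 'I_n) : turn j z = ((z + j) %% n)%N :> nat.
Proof.
elim: j => [|j IH]; first by rewrite addn0 modn_small.
by rewrite turnS /= IH -addn1 modnDml addn1 addnS.
Qed.

Lemma turn_period n (z : 'I_n) : turn n z = z.
Proof. by apply: ord_inj; rewrite val_turn modnDr modn_small. Qed.

Lemma turn_orbit_inj n (z : 'I_n) : injective (fun j : 'I_n => turn j z).
Proof.
move=> i j /= /(congr1 (@nat_of_ord n)); rewrite !val_turn => /eqP.
rewrite eqn_modDl => /eqP; rewrite !modn_small // => ?; exact: val_inj.
Qed.

Lemma big_turn (V : Type) (idx : V) (op : Monoid.com_law idx) n (z : 'I_n)
    (F : 'I_n -> V) :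
  \big[op/idx]_(j < n) F (turn j z) = \big[op/idx]_x F x.
Proof.
rewrite [RHS](reindex (fun j : 'I_n => turn j z)) //.
have [g fK gK] := injF_bij (@turn_orbit_inj n z).
by exists g => j _; [exact: fK|exact: gK].
Qed.

Lemma turn_transitive n (z y : 'I_n) : exists2 j, (j < n)%N & turn j z = y.
Proof.
have [g _ gK] := injF_bij (@turn_orbit_inj n z).
by exists (g y); [exact: ltn_ord | exact: gK].
Qed.

(** * Arcs between consecutive sites of A *)

Section Gap.
Variables (n : nat) (A : {set 'I_n}).

(* Equals n when x is the only site of A, and n + 1 when A is empty. *)
Definition gap (x : 'I_n) : nat :=
  (find (fun j => turn j.+1 x \in A) (iota 0 n)).+1.

Definition next_site (x : 'I_n) : 'I_n := turn (gap x) x.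

Lemma gap_min x j : (0 < j < gap x)%N -> turn j x \notin A.
Proof.
case: j => // j /andP[_]; rewrite ltnS => jg.
have := before_find 0%N jg; rewrite nth_iota ?add0n => [->//|].
by apply: leq_trans jg _; rewrite -[X in (_ <= X)%N](size_iota 0 n) find_size.
Qed.

Lemma gap_le x j : (0 < j)%N -> turn j x \in A -> (gap x <= j)%N.
Proof.
move=> j0 jA; rewrite leqNgt; apply/negP => jg.
by have := gap_min (introT andP (conj j0 jg)); rewrite jA.
Qed.

Lemma next_site_in x : x \in A -> next_site x \in A.
Proof.
move=> xA; rewrite /next_site /gap.
have h : has (fun j => turn j.+1 x \in A) (iota 0 n).
  apply/hasP; have n0 : (0 < n)%N := leq_ltn_trans (leq0n _) (ltn_ord x).
  exists n.-1; first by rewrite mem_iota add0n; lia.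
  by rewrite prednK // turn_period.
have := nth_find 0%N h; rewrite nth_iota ?add0n //.
by move: h; rewrite has_find size_iota.
Qed.

(** The arcs of length [gap x] issued from the sites x of A are disjoint, so the pairs (x, j) with
    [j < gap x] inject into the ring through [turn j x]. *)
Lemma sum_gap_le : (\sum_(x in A) gap x <= n)%N.
Proof.
pose T := {x : 'I_n & 'I_(gap x)}.
pose D := [set u : T | tag u \in A].
have -> : (\sum_(x in A) gap x)%N = #|D|.
  rewrite -sum1_card (eq_bigl (fun u : T => (tag u \in A) && true)); last first.
    by move=> u; rewrite inE andbT.
  rewrite -(sig_big_dep (fun x => x \in A) (fun x (j : 'I_(gap x)) => true)
    (fun x j => 1%N)) /=.
  by apply: eq_bigr => x _; rewrite sum1_card card_ord.
pose f (u : T) := turn (tagged u) (tag u).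
rewrite -[X in (_ <= X)%N]card_ord -(card_in_imset (f := f)); last first.
  (* Two arcs that meet make x the site [j - i] steps after y. As x is in A and [j - i < gap y],
     this forces [j = i]. *)
  have key (x y : 'I_n) i j : x \in A -> (i <= j < gap y)%N ->
      turn i x = turn j y -> x = y /\ i = j.
    move=> xA /andP[ij jg]; rewrite -(subnKC ij) turnD => /turn_inj xy.
    have ji : (j - i = 0)%N.
      apply/eqP; rewrite -leqn0 leqNgt; apply/negP => ji0.
      have := @gap_min y (j - i); rewrite ji0 -xy xA => /(_ _)/negP; apply => //.
      by apply: leq_ltn_trans jg; rewrite leq_subr.
    by move: xy; rewrite ji; split => //; rewrite addn0.
  move=> [x i] [y j]; rewrite !inE /f /= => xA yA fe.
  have [ij|/ltnW ij] := leqP i j.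
    have [] := key x y i j xA _ fe; first by rewrite ij ltn_ord.
    by move=> xy; subst y => /val_inj ->.
  have [] := key y x j i yA _ (esym fe); first by rewrite ij ltn_ord.
  by move=> xy; subst y => /val_inj ->.
exact: max_card.
Qed.

End Gap.

(** * Weights solving the cyclic system *)

Section Weights.
Variables (R : realFieldType) (n : nat) (A : {set 'I_n}) (theta : 'I_n -> R).
Hypothesis theta_gt0 : forall x, 0 < theta x.
Hypothesis A_gt0 : (0 < #|A|)%N.
Hypothesis theta_lt1 : \prod_(x in A) theta x < 1.

(* The cyclic linear system [u x = 1 + theta x * u (next_site A x)] is solved
   on the whole ring, where off A it reads [u z = u (ordS z)]. *)
Let th z := if z \in A then theta z else 1.
Let partial_sum k z : R :=
  \sum_(j < k) (turn j z \in A)%:R * \prod_(i < j) th (turn i z).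
(** Unrolling the recurrence forever gives a series in which each further tour of the ring is
    multiplied by [\prod theta]. Summing this geometric progression yields the quotient. *)
Let u z := partial_sum n z / (1 - \prod_(x in A) theta x).

Let th_gt0 z : 0 < th z. Proof. by rewrite /th; case: ifP. Qed.

Let prod_th z : \prod_(i < n) th (turn i z) = \prod_(x in A) theta x.
Proof. by rewrite (big_turn _ z th) [RHS]big_mkcond. Qed.

Let u_gt0 z : 0 < u z.
Proof.
rewrite divr_gt0 ?subr_gt0 // /partial_sum.
have /card_gt0P[y yA] := A_gt0.
have [j jn jy] := turn_transitive z y.
rewrite (bigD1 (Ordinal jn)) //= jy yA mul1r ltr_wpDr //.
  by apply: sumr_ge0 => i _; rewrite mulr_ge0 ?ler0n // prodr_ge0 // => ? _; exact: ltW.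
by apply: prodr_gt0 => i _.
Qed.

(** [partial_sum n.+1 z] is computed twice, by splitting off its first term and its last one. The
    last carries the full product because its site is [turn n z = z]. *)
Let u_rec z : th z * u (ordS z) = u z - (z \in A)%:R.
Proof.
have d0 : 1 - \prod_(x in A) theta x != 0 by rewrite subr_eq0 gt_eqF.
have e1 : partial_sum n.+1 z = (z \in A)%:R + th z * partial_sum n (ordS z).
  rewrite /partial_sum big_ord_recl big_ord0 mulr1 mulr_sumr; congr (_ + _).
  apply: eq_bigr => j _; rewrite big_ord_recl /= mulrCA -turnS turnSr.
  by congr (_ * (_ * _)); apply: eq_bigr => i _; rewrite -turnS turnSr.
have e2 : partial_sum n.+1 z =
    partial_sum n z + (z \in A)%:R * \prod_(x in A) theta x.
  by rewrite /partial_sum big_ord_recr /= turn_period prod_th.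
rewrite /u mulrA (_ : th z * _ =
  partial_sum n z - (z \in A)%:R * (1 - \prod_(x in A) theta x)); last first.
  move: e1; rewrite e2; lra.
by rewrite mulrBl mulfK.
Qed.

Let u_next x : u (ordS x) = u (next_site A x).
Proof.
rewrite /next_site /gap; set g := find _ _.
have: (g < gap A x)%N by [].
elim: g => [|g IH] // gg; rewrite IH ?(ltnW gg) //.
have := u_rec (turn g.+1 x).
by rewrite /th (negbTE (gap_min _)) ?gg // mul1r subr0 -turnS.
Qed.

(** The weights are [w x = 1 - 1 / u x]. By the recurrence
    [w x = theta x * u (next_site A x) / u x], so the u cancel around the cycle in the product, and
    both sides of the third clause equal [theta x / u x]. The last clause amounts to
    [u x >= 1 + theta x], which holds as [u > 1] at the next site. *)
Lemma exists_weights : exists w : 'I_n -> R,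
  [/\ forall x, x \in A -> 0 < w x < 1,
      \prod_(x in A) w x = \prod_(x in A) theta x,
      forall x, x \in A -> theta x * (1 - w x) = w x * (1 - w (next_site A x)) &
      forall x, x \in A -> theta x <= w x * (1 + theta x)].
Proof.
have uE x : x \in A -> theta x * u (next_site A x) = u x - 1.
  by move=> xA; rewrite -u_next; have := u_rec x; rewrite /th xA.
have u0 x : u x != 0 by rewrite gt_eqF.
have u1 x : x \in A -> 1 < u x.
  by move=> xA; rewrite -subr_gt0 -uE // mulr_gt0.
have u1' x : x \in A -> 1 <= u x by move=> /u1/ltW.
exists (fun x => 1 - (u x)^-1); split.
- move=> x xA; rewrite subr_gt0 invf_lt1 // u1 //=.
  by rewrite ltrBlDr ltrDl invr_gt0.
- have -> : \prod_(x in A) (1 - (u x)^-1) = \prod_x (th x * u (ordS x) / u x).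
    rewrite big_mkcond; apply: eq_bigr => x _; rewrite u_rec.
    by case: ifP => _; rewrite ?subr0 ?mulrBl ?divff ?mul1r.
  have us : \prod_x u (ordS x) = \prod_x u x.
    by rewrite [RHS](reindex_inj (@ordS_inj n)).
  rewrite big_split big_split /= us -mulrA -big_split /= [X in _ * X]big1 ?mulr1.
    by rewrite [RHS]big_mkcond.
  by move=> x _; rewrite divff.
- move=> x xA; have e := uE _ xA.
  have -> : theta x = (u x - 1) / u (next_site A x) by rewrite -e mulfK.
  field; by rewrite !u0.
- move=> x xA; have e := uE _ xA.
  have yA := next_site_in xA.
  have h : theta x <= u x - 1 by rewrite -e ler_peMr ?ltW// u1.
  rewrite -(ler_pM2r (u_gt0 x)) mulrAC mulrBl mul1r mulVf //.
  by have := u1 x xA; have := theta_gt0 x; nra.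
Qed.

End Weights.

(** * Topplings and the abelian property *)

Section Instructions.
Variables (n : nat) (A : {set 'I_n}).
Implicit Types (eta : config n) (x y : 'I_n).

(* [None] is the instruction to sleep, which is ignored outside A; [Some true]
   and [Some false] are jumps to the right and to the left. *)
Definition topple (i : option bool) x eta : config n :=
  match i with
  | None => if x \in A then sleep_at x eta else eta
  | Some true => jump x (ordS x) eta
  | Some false => jump x (ord_pred x) eta
  end.

Definition awake eta x : bool := (0 < nactive (eta x))%N.

Lemma jumpE x y eta z : jump x y eta z =
  let v := if z == x then remove_walk (eta z) else eta z in
  if z == y then add_walk v else v.
Proof. by rewrite !ffunE /=; case: ifP => // _; rewrite ffunE. Qed.

Lemma sleep_atE x eta z :
  sleep_at x eta z = if z == x then try_sleep (eta z) else eta z.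
Proof. by rewrite ffunE. Qed.

Lemma awakeP eta x : awake eta x -> exists k, eta x = Some k.+1.
Proof. by rewrite /awake; case: (eta x) => [[|k]|] //= _; exists k. Qed.

Lemma topple_awake i x y eta : x != y -> awake eta y -> awake (topple i x eta) y.
Proof.
move=> xy /awakeP[k ek]; rewrite /awake.
have j z : (0 < nactive (jump x z eta y))%N.
  by rewrite jumpE /= (eq_sym y x) (negbTE xy) ek; case: ifP.
case: i => [[]|] /=; rewrite ?j //.
by case: ifP => _; rewrite ?sleep_atE ?(eq_sym y x) ?(negbTE xy) ek.
Qed.

(** The delicate case is [z = x] with a lone walk at x: if it falls asleep first, the arriving walk
    wakes it, and [s + 1 = 2] is also the outcome of the other order. *)
Lemma sleep_jumpC x y z eta : x != y -> awake eta x ->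
  sleep_at x (jump y z eta) = jump y z (sleep_at x eta).
Proof.
move=> xy /awakeP[k ek]; apply/ffunP => t.
rewrite sleep_atE !jumpE /= sleep_atE.
have [->|tx] := eqVneq t x; last by [].
rewrite (negbTE xy) ek; case: eqP => // _.
by case: k {ek}.
Qed.

Lemma jump_jumpC x x' y y' eta : x != y -> awake eta x -> awake eta y ->
  jump x x' (jump y y' eta) = jump y y' (jump x x' eta).
Proof.
move=> xy /awakeP[k ek] /awakeP[l el]; apply/ffunP => t.
rewrite !jumpE /=.
have [->|tx] := eqVneq t x.
  by rewrite ek (negbTE xy); case: eqP; case: eqP.
have [->|ty] := eqVneq t y; first by rewrite el; case: eqP; case: eqP.
by case: eqP; case: eqP.
Qed.

Lemma toppleC i j x y eta : x != y -> awake eta x -> awake eta y ->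
  topple i x (topple j y eta) = topple j y (topple i x eta).
Proof.
move=> xy ax ay; have yx : y != x by rewrite eq_sym.
case: i => [[]|]; case: j => [[]|] /=.
all: rewrite 1?jump_jumpC //.
all: do ?[case: (boolP (_ \in A)) => _ //=]; rewrite 1?sleep_jumpC //.
apply/ffunP => t; rewrite !sleep_atE.
by have [->|] := eqVneq t x; rewrite ?(negbTE xy) //.
Qed.

Definition walks eta : nat := (\sum_x (if eta x is Some k then k else 1))%N.

Lemma walks_sleep_at x eta : walks (sleep_at x eta) = walks eta.
Proof.
apply: eq_bigr => z _; rewrite sleep_atE; case: ifP => // _.
by rewrite /try_sleep; case: eqP => // ->.
Qed.

Lemma walks_jump x y eta : awake eta x -> walks (jump x y eta) = walks eta.
Proof.
move=> /awakeP[k ek]; rewrite /walks.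
pose size v := (if v is Some k then k else 1)%N.
(* Mass balance of an update at one site, with terms on both sides so that no truncated subtraction
   occurs. *)
have up f (e : config n) z : (\sum_t size (update f z e t) + size (e z) =
    \sum_t size (e t) + size (f (e z)))%N.
  rewrite (bigD1 z) //= [in RHS](bigD1 z) //= ffunE eqxx.
  rewrite (eq_bigr (fun t => size (e t))); last first.
    by move=> t tz; rewrite ffunE (negbTE tz).
  by rewrite addnC [X in (_ + X)%N]addnC addnA.
have add v : size (add_walk v) = (size v).+1 by case: v.
apply: (@addIn (size (update remove_walk x eta y))).
rewrite [LHS](up add_walk (update remove_walk x eta) y) add addnS.
rewrite -addSn; congr (_ + _)%N.
by apply: (@addIn k); have := up remove_walk eta x; rewrite ek /= addnS -addSn.
Qed.

Lemma walks_topple i x eta : awake eta x -> walks (topple i x eta) = walks eta.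
Proof.
move=> ax; case: i => [[]|] /=; rewrite ?walks_jump //.
by case: ifP; rewrite ?walks_sleep_at.
Qed.

Definition asleep_on : config n := [ffun x => if x \in A then None else Some 0%N].

Lemma asleep_on_awake x : awake asleep_on x = false.
Proof. by rewrite /awake ffunE; case: ifP. Qed.

Lemma walks_asleep_on : walks asleep_on = #|A|.
Proof.
rewrite -sum1_card big_mkcond; apply: eq_bigr => x _; rewrite ffunE.
by case: ifP.
Qed.

End Instructions.

(** * Probability of settling exactly on A *)

Section Abelian.
Variables (R : realFieldType) (lambda : R) (n : nat) (A : {set 'I_n}).
Hypothesis lambda_gt0 : 0 < lambda.
Implicit Types (eta : config n) (x y : 'I_n) (f g : config n -> R).

Definition mean_topple x f eta : R :=
  lambda / (1 + lambda) * f (topple A None x eta) +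
  2^-1 * (1 + lambda)^-1 * f (topple A (Some true) x eta) +
  2^-1 * (1 + lambda)^-1 * f (topple A (Some false) x eta).

Lemma mean_topple_le x f g eta :
  (forall i, f (topple A i x eta) <= g (topple A i x eta)) ->
  mean_topple x f eta <= mean_topple x g eta.
Proof.
by move=> fg; rewrite !lerD // ler_wpM2l // ?mulr_ge0 ?invr_ge0 ?ltW // ltr_wpDl.
Qed.

Lemma eq_mean_topple x f g eta :
  (forall i, f (topple A i x eta) = g (topple A i x eta)) ->
  mean_topple x f eta = mean_topple x g eta.
Proof. by move=> fg; rewrite /mean_topple !fg. Qed.

Lemma mean_topple_cst x c eta : mean_topple x (fun=> c) eta = c.
Proof.
rewrite /mean_topple; field; rewrite gt_eqF // ltr_wpDl //.
Qed.

Lemma mean_toppleC x y f eta : x != y -> awake eta x -> awake eta y ->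
  mean_topple x (mean_topple y f) eta = mean_topple y (mean_topple x f) eta.
Proof.
move=> xy ax ay; have yx : y != x by rewrite eq_sym.
rewrite /mean_topple !(toppleC A _ _ yx ay ax).
ring.
Qed.

(* Probability that k topplings at sites picked arbitrarily are enough to turn
   eta into [asleep_on A]. *)
Fixpoint settle_prob (k : nat) (eta : config n) : R :=
  if k is k'.+1 then
    if eta == asleep_on A then 1
    else if [pick x | awake eta x] is Some x
    then mean_topple x (settle_prob k') eta else 0
  else (eta == asleep_on A)%:R.

Lemma settle_prob_ge0 k eta : 0 <= settle_prob k eta.
Proof.
elim: k eta => [|k IH] eta /=; first by rewrite ler0n.
case: ifP => // _; case: pickP => // x _.
by rewrite -[leLHS](mean_topple_cst x 0 eta); exact: mean_topple_le.
Qed.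

Lemma settle_prob_le1 k eta : settle_prob k eta <= 1.
Proof.
elim: k eta => [|k IH] eta /=; first by rewrite lern1 leq_b1.
case: ifP => // _; case: pickP => // x _.
by rewrite -[leRHS](mean_topple_cst x 1 eta); exact: mean_topple_le.
Qed.

Lemma settle_prob_nondecreasing k eta : settle_prob k eta <= settle_prob k.+1 eta.
Proof.
elim: k eta => [|k IH] eta.
  rewrite /=; case: eqP => // _; case: pickP => // x _.
  rewrite -[leLHS](mean_topple_cst x 0 eta); apply: mean_topple_le => i.
  by rewrite ler0n.
rewrite /=; case: eqP => // _; case: pickP => // x _.
exact: mean_topple_le.
Qed.

Lemma settle_prob_asleep_on k : settle_prob k (asleep_on A) = 1.
Proof. by case: k => [|k] /=; rewrite eqxx. Qed.

Lemma awake_neq_asleep_on eta x : awake eta x -> (eta == asleep_on A) = false.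
Proof. by move=> ax; apply/eqP => e; rewrite e asleep_on_awake in ax. Qed.

(* The abelian property: topplings at two awake sites commute, and neither of
   them puts the other site to sleep. *)
Lemma settle_prob_topple k eta x : awake eta x ->
  settle_prob k.+1 eta = mean_topple x (settle_prob k) eta.
Proof.
elim: k eta x => [|k IH] eta x ax.
  rewrite /= (awake_neq_asleep_on ax); case: pickP => [y ay|/(_ x)]; last by rewrite ax.
  have [->//|yx] := eqVneq y x.
  have xy : x != y by rewrite eq_sym.
  (* With one toppling left and two awake sites both sides vanish, since the site not toppled is
     still awake afterwards. *)
  rewrite (@eq_mean_topple y _ (fun=> 0)) ?mean_topple_cst; last first.
    by move=> i; rewrite (awake_neq_asleep_on (topple_awake A i yx ax)).
  rewrite (@eq_mean_topple x _ (fun=> 0)) ?mean_topple_cst //.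
  by move=> i; rewrite (awake_neq_asleep_on (topple_awake A i xy ay)).
rewrite [LHS]/= (awake_neq_asleep_on ax).
case: pickP => [y ay|/(_ x)]; last by rewrite ax.
have [->//|yx] := eqVneq y x.
have xy : x != y by rewrite eq_sym.
rewrite -/(settle_prob k.+1).
rewrite (@eq_mean_topple y _ (mean_topple x (settle_prob k))); last first.
  by move=> i; apply: IH; exact: topple_awake.
rewrite mean_toppleC //; apply: eq_mean_topple => i.
by rewrite (IH _ y) //; exact: topple_awake.
Qed.

Lemma settle_prob_walks k eta : walks eta != #|A| -> settle_prob k eta = 0.
Proof.
elim: k eta => [|k IH] eta h /=.
  by case: eqP => // e; rewrite e walks_asleep_on eqxx in h.
case: eqP => [e|_]; first by rewrite e walks_asleep_on eqxx in h.
case: pickP => // x ax; rewrite (@eq_mean_topple x _ (fun=> 0)) ?mean_topple_cst //.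
by move=> i; apply: IH; rewrite walks_topple.
Qed.

End Abelian.

(** * The supermartingale *)

Lemma jump_eq_None n x y (eta : config n) z :
  awake eta x -> jump x y eta z = None -> eta z = None /\ z != y.
Proof.
move=> /awakeP[k ek]; rewrite jumpE /=.
have [->|zx] := eqVneq z x; first by rewrite ek /=; case: eqP.
by case: eqP => // _; case: (eta z).
Qed.

Lemma awake_jump n x y (eta : config n) : awake (jump x y eta) y.
Proof. by rewrite /awake jumpE eqxx /=; case: (if _ then _ else _). Qed.

(** Hopping from x along the successive sites of A cannot jump over y, by [gap_le]. Strong induction
    on the distance to y then finds a hop that leaves P. *)
Lemma exists_boundary n (A : {set 'I_n}) (P : pred 'I_n) x y :
  x \in A -> P x -> y \in A -> ~~ P y ->
  exists z, [/\ z \in A, P z & ~~ P (next_site A z)].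
Proof.
move=> + + yA Py; have [j _ jy] := turn_transitive x y.
elim/ltn_ind: j x jy => j IH x jy xA Px.
have [Pn|] := boolP (P (next_site A x)); last by exists x.
have j0 : (0 < j)%N by case: j jy {IH} => // xy; rewrite -xy Px in Py.
have gj : (gap A x <= j)%N by apply: gap_le; rewrite ?jy.
apply: (IH (j - gap A x)%N _ (next_site A x)) => //; last exact: next_site_in.
  by rewrite -subn_gt0 subKn.
by rewrite /next_site -turnD subnK.
Qed.

Section Potential.
Variables (R : realFieldType) (lambda : R) (n : nat) (A : {set 'I_n}).
Variable w : 'I_n -> R.
Hypothesis lambda_gt0 : 0 < lambda.
Let theta x : R := 2 * lambda * (gap A x)%:R.
Hypothesis w01 : forall x, x \in A -> 0 < w x < 1.
Hypothesis w_eq : forall x, x \in A ->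
  theta x * (1 - w x) = w x * (1 - w (next_site A x)).
Hypothesis w_ge : forall x, x \in A -> theta x <= w x * (1 + theta x).
Implicit Types (eta : config n) (x y z : 'I_n).

Definition potential eta : R :=
  \prod_(x in A) (if eta x is Some _ then w x else 1).

Let fac_gt0 eta x : x \in A -> 0 < (if eta x is Some _ then w x else 1).
Proof. by move=> /w01/andP[? _]; case: (eta x). Qed.

Lemma potential_gt0 eta : 0 < potential eta.
Proof. by apply: prodr_gt0 => x; exact: fac_gt0. Qed.

Lemma potential_le eta eta' : (forall x, x \in A -> eta' x = None -> eta x = None) ->
  potential eta' <= potential eta.
Proof.
move=> h; apply: ler_prod => x xA; rewrite ltW ?fac_gt0 //=.
move: (h x xA); have /andP[_ /ltW] := w01 xA.
by case: (eta' x) => [?|] // => [|_ ->] //; case: (eta x).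
Qed.

Lemma potential_wake eta eta' y : y \in A -> eta y = None -> eta' y <> None ->
  (forall x, x \in A -> eta' x = None -> eta x = None) ->
  potential eta' <= potential eta * w y.
Proof.
move=> yA ey ey' h; rewrite /potential (bigD1 y) //= [X in _ <= X * _](bigD1 y) //=.
rewrite ey mul1r; move: ey'; case: (eta' y) => // v _; rewrite mulrC.
rewrite ler_wpM2r //; first by case/andP: (w01 yA) => /ltW.
apply: ler_prod => x /andP[xA _]; rewrite ltW ?fac_gt0 //=.
move: (h x xA); have /andP[_ /ltW] := w01 xA.
by case: (eta' x) => [?|] // => [|_ ->] //; case: (eta x).
Qed.

(** Equality holds when the walk is alone at x; otherwise the attempt fails and dividing by
    [w x < 1] only increases the right side. *)
Lemma potential_sleep eta x : x \in A -> awake eta x ->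
  potential (sleep_at x eta) <= potential eta / w x.
Proof.
move=> xA /awakeP[k ek]; have /andP[w0 w1] := w01 xA.
rewrite ler_pdivlMr // /potential (bigD1 x) //= [leRHS](bigD1 x) //=.
rewrite sleep_atE eqxx ek (eq_bigr (fun z => if eta z is Some _ then w z else 1)); last first.
  by move=> z /andP[_ zx]; rewrite sleep_atE (negbTE zx).
rewrite mulrAC ler_wpM2r //.
  by apply: prodr_ge0 => z /andP[zA _]; rewrite ltW ?fac_gt0.
apply: ler_piMl; first exact: ltW.
by case: try_sleep => [?|] //; exact: ltW.
Qed.

Definition admissible eta : Prop :=
  walks eta = #|A| /\ forall x, x \notin A -> eta x <> None.

Lemma admissible_topple i x eta :
  awake eta x -> admissible eta -> admissible (topple A i x eta).
Proof.
move=> ax [wA sA]; split; first by rewrite walks_topple.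
move=> z zA; case: i => [[]|] /=; first 2 last.
- case: ifP => xA; last exact: sA.
  rewrite sleep_atE; case: eqP => [e|_]; last exact: sA.
  by rewrite e xA in zA.
- by move/(jump_eq_None ax) => [/(sA _ zA)].
- by move/(jump_eq_None ax) => [/(sA _ zA)].
Qed.

(** The sites whose toppling can put no walk to sleep. They are toppled first, at no cost to the
    potential. *)
Definition excess eta z : bool :=
  if z \in A then (1 < nactive (eta z))%N else awake eta z.

Lemma excess_awake eta z : excess eta z -> awake eta z.
Proof. by rewrite /excess; case: ifP => // _ /ltnW. Qed.

Lemma excess_topple_None eta i z x : excess eta z ->
  topple A i z eta x = None -> eta x = None.
Proof.
move=> ez; have az := excess_awake ez.
case: i => [[]|] /=; [by case/(jump_eq_None az)|by case/(jump_eq_None az)|].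
move: ez; rewrite /excess; case: ifP => // _.
rewrite sleep_atE; case: eqP => // ->.
by case: (eta z) => [[|[|k]]|].
Qed.

(** Counting: [#|A|] walks, none of them off A and at most one on each site of A, leave exactly one
    per site of A. *)
Lemma settledP eta : admissible eta -> (forall z, ~~ excess eta z) ->
  forall x, eta x = if x \in A then (if awake eta x then Some 1%N else None) else Some 0%N.
Proof.
move=> [wA sA] ne.
have le1 x : x \in A -> ((if eta x is Some k then k else 1) <= 1)%N.
  move=> xA; move: (ne x); rewrite /excess xA -leqNgt; by case: (eta x).
have out x : x \notin A -> eta x = Some 0%N.
  move=> xA; move: (ne x) (sA x xA); rewrite /excess (negbTE xA) /awake.
  by case: (eta x) => [[]|].
move=> x; case: ifP => xA; last by rewrite out ?xA.
suff h : (0 < (if eta x is Some k then k else 1))%N.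
  by move: (le1 x xA) h; rewrite /awake; case: (eta x) => [[|[|]]|].
rewrite lt0n; apply/eqP => e0; move: wA.
rewrite /walks (bigID [in A]) /= [X in (_ + X)%N]big1 ?addn0; last first.
  by move=> z zA; rewrite out.
rewrite -sum1_card (bigD1 x) //= [RHS](bigD1 x) //= e0 add0n => /eqP.
rewrite eqn_leq => /andP[_]; rewrite leqNgt => /negP; apply.
by rewrite add1n ltnS; apply: leq_sum => z /andP[/le1].
Qed.

(* Factor gained when a walk stands at distance j to the right of x and the next
   site of A is asleep: the harmonic interpolation between 1 at x and
   [w (next_site A x)] at the next site. *)
Let phi x (j : nat) : R := 1 - j%:R / (gap A x)%:R * (1 - w (next_site A x)).

Let phi_ge0 x j : x \in A -> (j <= gap A x)%N -> 0 <= phi x j.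
Proof.
move=> xA jg; have /andP[wy0 wy1] := w01 (next_site_in xA).
have g0 : 0 < (gap A x)%:R :> R by rewrite ltr0n.
have q1 : j%:R / (gap A x)%:R <= 1 :> R by rewrite ler_pdivrMr // mul1r ler_nat.
have q0 : 0 <= j%:R / (gap A x)%:R :> R by rewrite divr_ge0.
rewrite /phi; nra.
Qed.

Let total : R := \prod_(x in A) w x.
(** The price of one toppling when all of A is awake. The potential is then [total] and may rise to
    [total / w x], while [w_ge] and [gap A x >= 1] give [1 / w x <= 1 + 1 / (2 lambda)]. *)
Let eps : R := total * (1 + (2 * lambda)^-1).

Let total_gt0 : 0 < total.
Proof. by apply: prodr_gt0 => x /w01/andP[]. Qed.

Let eps_ge0 : 0 <= eps.
Proof. by rewrite mulr_ge0 ?addr_ge0 ?invr_ge0 ?mulr_ge0 // ltW. Qed.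

Let bound1 k := forall eta, admissible eta ->
  settle_prob lambda A k eta <= potential eta + k%:R * eps.

(** Sharper bound during the excursion of a walk between x and its sleeping successor: the factor
    [phi x j] anticipates the gain obtained if the successor is woken. *)
Let bound2 k := forall eta x j, admissible eta -> x \in A ->
  (0 < j < gap A x)%N -> awake eta (turn j x) -> eta (next_site A x) = None ->
  settle_prob lambda A k eta <= potential eta * phi x j + k%:R * eps.

(** Three landing spots. At [j = 0] the walk is at x and [phi] is 1; at [j = gap A x] it wakes the
    next site, whose weight enters the potential; in between [bound2] applies. *)
Let jump_bound k eta x z j : bound1 k -> bound2 k -> admissible eta ->
  awake eta z -> x \in A -> eta (next_site A x) = None -> (j <= gap A x)%N ->
  admissible (jump z (turn j x) eta) ->
  settle_prob lambda A k (jump z (turn j x) eta) <=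
  potential eta * phi x j + k%:R * eps.
Proof.
move=> b1 b2 ok az xA ey jg ok'.
have sub t : t \in A -> jump z (turn j x) eta t = None -> eta t = None.
  by move=> _ /(jump_eq_None az)[].
have g0 : (gap A x)%:R != 0 :> R by rewrite pnatr_eq0.
have [j0|j0] := posnP j.
  apply: le_trans (b1 _ ok') _; rewrite lerD2r.
  by rewrite /phi [in X in 1 - X]j0 mul0r mul0r subr0 mulr1; exact: potential_le.
move: jg; rewrite leq_eqVlt => /predU1P[jg|jg].
  apply: le_trans (b1 _ ok') _; rewrite lerD2r.
  rewrite /phi jg divff // mul1r subKr.
  apply: potential_wake; rewrite -/(next_site A x) //; first exact: next_site_in.
    by move=> e; have := awake_jump z (next_site A x) eta; rewrite /awake e.
  by rewrite /next_site -jg.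
apply: le_trans (b2 _ x j ok' xA _ _ _) _.
- by rewrite j0.
- exact: awake_jump.
- rewrite jumpE /=; case: eqP => [e|_].
    have := @gap_min _ A x j; rewrite j0 jg -e next_site_in //.
    by move=> /(_ isT).
  by case: eqP => // e; move: az; rewrite -e /awake ey.
by rewrite lerD2r ler_wpM2r ?phi_ge0 ?(ltnW jg) //; exact: potential_le.
Qed.

Let bound1_step k : bound1 k -> bound2 k -> bound1 k.+1.
Proof.
move=> b1 b2 eta ok.
have kS : k.+1%:R * eps = k%:R * eps + eps by rewrite -addn1 natrD mulrDl mul1r.
(* Four cases: an excess walk to topple, A entirely asleep, A entirely awake, and A partly awake. *)
have [z ez|ne] := pickP (excess eta).
  have az := excess_awake ez.
  rewrite (settle_prob_topple A lambda_gt0 _ az).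
  apply: le_trans (_ : mean_topple lambda A z
    (fun=> potential eta + k%:R * eps) eta <= _); last first.
    by rewrite mean_topple_cst // lerD2l kS lerDl.
  apply: mean_topple_le => // i; apply: le_trans (b1 _ _) _.
    exact: admissible_topple.
  rewrite lerD2r; apply: potential_le => x _; exact: excess_topple_None.
have st := settledP ok (fun z => negbT (ne z)).
have [x0 /andP[x0A ax0]|na] := pickP [pred x | (x \in A) && awake eta x]; last first.
  have -> : eta = asleep_on A.
    apply/ffunP => x; rewrite st ffunE; case: ifP => // xA.
    by move: (na x); rewrite /= xA /= => ->.
  rewrite settle_prob_asleep_on /potential big1; last first.
    by move=> x xA; rewrite ffunE xA.
  by rewrite lerDl mulr_ge0.
(* With all of A awake there is no sleeping neighbour to exploit, and the possible increase of the
   potential is paid by [eps]. *)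
have [y0 /andP[y0A ay0]|al] := pickP [pred y | (y \in A) && ~~ awake eta y]; last first.
  rewrite (settle_prob_topple A lambda_gt0 _ ax0).
  have allA x : x \in A -> awake eta x.
    by move=> xA; move: (al x) => /=; rewrite xA /= => /negbFE.
  have potE : potential eta = total.
    by apply: eq_bigr => x xA; rewrite st xA allA.
  have /andP[w0 w1] := w01 x0A.
  have pw : potential eta <= potential eta / w x0.
    by rewrite ler_pdivlMr // ler_piMr ?ltW // potential_gt0.
  apply: le_trans (_ : mean_topple lambda A x0
    (fun=> potential eta / w x0 + k%:R * eps) eta <= _).
    apply: mean_topple_le => // i; apply: le_trans (b1 _ _) _.
      exact: admissible_topple.
    rewrite lerD2r; case: i => [b|]; last first.
      by rewrite /= x0A; exact: potential_sleep.
    apply: le_trans pw; apply: potential_le => x _.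
    by case: b => /= /(jump_eq_None ax0)[].
  rewrite mean_topple_cst // kS [leRHS]addrA [leRHS]addrAC lerD2r.
  rewrite potE /eps -[X in X + _](mulr1 total) -mulrDr ler_pM2l //.
  rewrite -(@ler_pM2r _ (w x0)) // mulVf ?gt_eqF //.
  have := w_ge x0A; rewrite /theta.
  have g1 : 1 <= (gap A x0)%:R :> R by rewrite ler1n.
  set g := (gap A x0)%:R in g1 *; set v := w x0 in w0 w1 *.
  have l2 : (2 * lambda)^-1 * (2 * lambda) = 1 by rewrite mulVf // gt_eqF ?mulr_gt0.
  have l0 : 0 < (2 * lambda)^-1 by rewrite invr_gt0 mulr_gt0.
  set l := (2 * lambda)^-1 in l2 l0 *; move=> hv.
  have hg : 2 * lambda * (1 - v) <= 2 * lambda * (1 - v) * g.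
    by rewrite ler_peMr // !mulr_ge0 ?subr_ge0 // ltW.
  have hl : l * (2 * lambda * (1 - v)) <= l * v.
    by rewrite ler_wpM2l ?(ltW l0) //; apply: le_trans hg _; lra.
  move: hl; rewrite mulrA l2 mul1r; nra.
have [x [xA ax nx]] := exists_boundary x0A ax0 y0A ay0.
have yA := next_site_in xA.
have ey : eta (next_site A x) = None by rewrite st yA (negbTE nx).
rewrite (settle_prob_topple A lambda_gt0 _ ax) /mean_topple.
have h0 : settle_prob lambda A k (topple A None x eta) <=
    potential eta / w x + k%:R * eps.
  apply: le_trans (b1 _ _) _; first exact: admissible_topple.
  by rewrite lerD2r /= xA; exact: potential_sleep.
have h1 : settle_prob lambda A k (topple A (Some true) x eta) <=
    potential eta * phi x 1 + k%:R * eps.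
  rewrite /= -[ordS x]/(turn 1 x); apply: jump_bound => //.
  exact: (admissible_topple (Some true)).
have h2 : settle_prob lambda A k (topple A (Some false) x eta) <=
    potential eta + k%:R * eps.
  apply: le_trans (b1 _ _) _; first exact: admissible_topple.
  by rewrite lerD2r; apply: potential_le => z _ /(jump_eq_None ax)[].
have /andP[w0 w1] := w01 xA.
have L0 : 0 < 1 + lambda by rewrite addr_gt0.
have q0 : 0 <= lambda / (1 + lambda) by rewrite divr_ge0 ?ltW.
have q1 : 0 <= 2^-1 * (1 + lambda)^-1 by rewrite mulr_ge0 ?invr_ge0 ?ltW.
apply: le_trans (lerD (lerD (ler_wpM2l q0 h0) (ler_wpM2l q1 h1)) (ler_wpM2l q1 h2)) _.
rewrite kS; apply: le_trans (_ : potential eta + k%:R * eps <= _); last first.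
  by rewrite lerD2l lerDl.
(* After division by the potential, the average over the three instructions equals 1 exactly when
   [2 lambda g (1 - w x) = w x (1 - w y)], where y is the next site and g its distance. This is
   [w_eq]. *)
have e := w_eq xA; rewrite /theta in e.
have g0 : (gap A x)%:R != 0 :> R by rewrite pnatr_eq0.
rewrite le_eqVlt; apply/orP; left; apply/eqP.
have ewy : 1 - w (next_site A x) = 2 * lambda * (gap A x)%:R * (1 - w x) / w x.
  by rewrite e mulrAC mulfV ?mul1r ?gt_eqF.
rewrite /phi ewy; field.
by rewrite g0 !gt_eqF.
Qed.

(** Off A the attempt to sleep is ignored and the two jumps are equally likely, while [phi x] is
    affine in j, so averaging preserves the bound. *)
Let bound2_step k : bound1 k -> bound2 k -> bound2 k.+1.
Proof.
move=> b1 b2 eta x j ok xA /andP[j0 jg] az ey.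
set z := turn j x in az.
have zA : z \notin A by apply: gap_min; rewrite j0.
rewrite (settle_prob_topple A lambda_gt0 _ az) /mean_topple.
have h0 : settle_prob lambda A k (topple A None z eta) <=
    potential eta * phi x j + k%:R * eps.
  by rewrite /= (negbTE zA); apply: b2; rewrite // j0.
have h1 : settle_prob lambda A k (topple A (Some true) z eta) <=
    potential eta * phi x j.+1 + k%:R * eps.
  rewrite /= -[ordS z]/(turn j.+1 x); apply: jump_bound => //.
  exact: (admissible_topple (Some true)).
have h2 : settle_prob lambda A k (topple A (Some false) z eta) <=
    potential eta * phi x j.-1 + k%:R * eps.
  have pz : ord_pred z = turn j.-1 x by rewrite /z -(prednK j0) turnS ordSK.
  rewrite /= pz; apply: jump_bound => //.
    by apply: leq_trans (ltnW jg); rewrite leq_pred.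
  by rewrite -pz; exact: (admissible_topple (Some false)).
have L0 : 0 < 1 + lambda by rewrite addr_gt0.
have q0 : 0 <= lambda / (1 + lambda) by rewrite divr_ge0 ?ltW.
have q1 : 0 <= 2^-1 * (1 + lambda)^-1 by rewrite mulr_ge0 ?invr_ge0 ?ltW.
apply: le_trans (lerD (lerD (ler_wpM2l q0 h0) (ler_wpM2l q1 h1)) (ler_wpM2l q1 h2)) _.
apply: le_trans (_ : potential eta * phi x j + k%:R * eps <= _); last first.
  by rewrite lerD2l ler_wpM2r // ler_nat.
have g0 : (gap A x)%:R != 0 :> R by rewrite pnatr_eq0.
rewrite le_eqVlt; apply/orP; left; apply/eqP.
have ej : j%:R = j.-1%:R + 1 :> R by rewrite natr1 prednK.
have ej1 : j.+1%:R = j.-1%:R + 2 :> R by rewrite -addn1 natrD ej -addrA.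
by rewrite /phi ej1 ej; field; rewrite g0 gt_eqF.
Qed.

Lemma settle_prob_potential k eta : admissible eta ->
  settle_prob lambda A k eta <=
  potential eta + k%:R * (\prod_(x in A) w x * (1 + (2 * lambda)^-1)).
Proof.
suff : bound1 k /\ bound2 k by case=> b _; exact: b.
elim: k => [|k [b1 b2]]; last by split; [exact: bound1_step|exact: bound2_step].
split=> [e ok|e x j ok xA /andP[j0 jg] az ey]; rewrite mul0r addr0 /=.
  case: eqP => [->|_]; last exact/ltW/potential_gt0.
  by rewrite /potential big1 // => x xA; rewrite ffunE xA.
rewrite (awake_neq_asleep_on _ az) mulr_ge0 ?phi_ge0 ?(ltnW jg) //.
exact/ltW/potential_gt0.
Qed.

End Potential.

(** When no walk is asleep the potential is the product of all the weights, that is [\prod theta].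
    The k possible costs [eps] are multiples of the same product. *)
Lemma settle_prob_le_prod_gap (R : realFieldType) (lambda : R) n (A : {set 'I_n})
    k (eta : config n) :
  0 < lambda -> (0 < #|A|)%N -> (forall x, eta x != None) ->
  settle_prob lambda A k eta <=
  (1 + k%:R * (1 + (2 * lambda)^-1)) * (walks eta == #|A|)%:R *
    \prod_(x in A) (2 * lambda * (gap A x)%:R).
Proof.
move=> l0 A0 ae; set th := fun x => 2 * lambda * (gap A x)%:R.
have [we|wn] := eqVneq (walks eta) #|A|; last by rewrite settle_prob_walks // mulr0 mul0r.
have th0 x : 0 < th x by rewrite !mulr_gt0 // ltr0n.
have c1 : 1 <= 1 + k%:R * (1 + (2 * lambda)^-1).
  by rewrite lerDl mulr_ge0 // addr_ge0 // invr_ge0 mulr_ge0 // ltW.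
rewrite mulr1.
(* If the product is at least 1 the claimed bound exceeds 1; otherwise the weights exist. *)
have [t1|t1] := ltrP (\prod_(x in A) th x) 1; last first.
  apply: le_trans (settle_prob_le1 A l0 k eta) _; nra.
have [w [w01 wp we' wg]] := exists_weights th0 A0 t1.
have ok : admissible A eta by split=> // x _; apply/eqP.
apply: le_trans (settle_prob_potential l0 w01 we' wg k ok) _.
rewrite wp (_ : potential _ _ _ = \prod_(x in A) th x); last first.
  by rewrite -wp; apply: eq_bigr => x _; case: (eta x) (ae x).
rewrite le_eqVlt; apply/orP; left; apply/eqP; ring.
Qed.

(** * Counting, and comparison with the jump chain *)

Section Counting.
Variable R : realType.

(** Arithmetic-geometric inequality: with [z = #|A| / n], each factor satisfies
    [gap x * z <= expR (gap x * z - 1)], and the exponents add up to at most 0 by [sum_gap_le]. *)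
Lemma prod_gap_le n (A : {set 'I_n}) : (0 < #|A|)%N ->
  \prod_(x in A) (gap A x)%:R <= (n%:R / #|A|%:R) ^+ #|A| :> R.
Proof.
move=> A0; have n0 : (0 < n)%N by apply: leq_trans A0 _; rewrite -[leqRHS]card_ord max_card.
have m0 : 0 < #|A|%:R :> R by rewrite ltr0n.
have nR0 : 0 < n%:R :> R by rewrite ltr0n.
pose z : R := #|A|%:R / n%:R.
have z0 : 0 < z by rewrite divr_gt0.
suff h : \prod_(x in A) ((gap A x)%:R * z) <= 1.
  move: h; rewrite big_split /= prodr_const -ler_pdivlMr ?exprn_gt0 //.
  by rewrite mul1r -exprVn invf_div.
apply: le_trans (_ : \prod_(x in A) expR ((gap A x)%:R * z - 1) <= _).
  apply: ler_prod => x _; rewrite mulr_ge0 ?(ltW z0) //=.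
  by apply: le_trans (expR_ge1Dx _); rewrite addrC subrK.
rewrite -expR_sum -[leRHS]expR0 ler_expR sumrB -mulr_suml sumr_const subr_le0.
rewrite -natr_sum mulrC -ler_pdivlMl // /z invf_div divfK ?gt_eqF //.
by rewrite ler_nat sum_gap_le.
Qed.

(** [C(n, m) z ^ m] is one term of [(1 + z) ^ n <= expR (n z)], taken at [z = m / n]. *)
Lemma bin_le n m : (0 < n)%N -> (0 < m)%N ->
  ('C(n, m))%:R <= (n%:R / m%:R) ^+ m * expR m%:R :> R.
Proof.
move=> n0 m0; have mR0 : 0 < m%:R :> R by rewrite ltr0n.
have nR0 : 0 < n%:R :> R by rewrite ltr0n.
pose z : R := m%:R / n%:R.
have z0 : 0 < z by rewrite divr_gt0.
rewrite -invf_div exprVn mulrC -/z ler_pdivlMr ?exprn_gt0 //.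
have [mn|nm] := leqP m n; last by rewrite bin_small // mul0r expR_ge0.
apply: le_trans (_ : (1 + z) ^+ n <= _).
  rewrite exprDn (bigD1 (Ordinal (mn : m < n.+1)%N)) //= expr1n mul1r mulr_natl.
  rewrite lerDl sumr_ge0 // => i _; rewrite expr1n mul1r.
  by rewrite mulrn_wge0 // exprn_ge0 // ltW.
apply: le_trans (_ : expR z ^+ n <= _).
  by rewrite lerXn2r ?nnegrE ?expR_ge0 ?expR_ge1Dx ?addr_ge0 ?ltW.
by rewrite -expRM_natl /z mulrC divfK ?gt_eqF.
Qed.

(** The sum is at most [(2 e lambda q ^ 2) ^ m] with [q = n / m <= 4 / zeta]. As
    [zeta > 6 e sqrt lambda], squaring [6 e q sqrt lambda <= 4] gives
    [2 e ^ 2 lambda q ^ 2 <= 16 / 18], so the base is below [1 / e]. *)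
Lemma sum_prod_gap_le (lambda zeta : R) n m : 0 < lambda ->
  6 * expR 1 * Num.sqrt lambda < zeta -> (0 < m)%N -> (0 < n)%N ->
  zeta * n%:R / 4 <= m%:R ->
  \sum_(A : {set 'I_n} | m == #|A|) \prod_(x in A) (2 * lambda * (gap A x)%:R)
    <= expR (- m%:R).
Proof.
move=> l0 lz m0 n0 zm; have mR0 : 0 < m%:R :> R by rewrite ltr0n.
have nR0 : 0 < n%:R :> R by rewrite ltr0n.
pose q : R := n%:R / m%:R.
have q0 : 0 < q by rewrite divr_gt0.
have e0 := expR_gt0 (1 : R).
apply: le_trans (_ : \sum_(A : {set 'I_n} | m == #|A|) (2 * lambda * q) ^+ m <= _).
  apply: ler_sum => A /eqP mA; rewrite big_split /= prodr_const -mA [leRHS]exprMn.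
  rewrite ler_wpM2l ?exprn_ge0 ?mulr_ge0 ?(ltW l0) //.
  by rewrite /q mA prod_gap_le -?mA.
rewrite sumr_const (_ : #|_| = 'C(n, m)); last first.
  rewrite -[in RHS](card_ord n) -card_draws; apply: eq_card => A.
  by rewrite !inE unfold_in eq_sym.
rewrite -[leLHS]mulr_natl; apply: le_trans (_ : q ^+ m * expR m%:R * (2 * lambda * q) ^+ m <= _).
  by rewrite ler_wpM2r ?exprn_ge0 ?mulr_ge0 ?(ltW l0) ?(ltW q0) // bin_le.
have eX x : expR (x *+ m) = expR x ^+ m :> R by rewrite -expRM_natl mulr_natl.
rewrite -[m%:R]/(1 *+ m) -mulNrn !eX -!exprMn.
rewrite lerXn2r ?nnegrE ?expR_ge0 ?mulr_ge0 ?(ltW l0) ?(ltW q0) ?(ltW e0) //.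
rewrite expRN -[leRHS]mul1r ler_pdivlMr //.
have s0 : 0 <= Num.sqrt lambda by rewrite sqrtr_ge0.
have s2 : Num.sqrt lambda ^+ 2 = lambda by rewrite sqr_sqrtr // ltW.
have qz : q * zeta <= 4.
  rewrite /q mulrAC ler_pdivrMr // mulrC; move: zm; rewrite ler_pdivrMr //; lra.
have z0 : 0 <= zeta by apply: ltW; apply: le_lt_trans lz; rewrite !mulr_ge0 // ltW.
have h : q * (6 * expR 1 * Num.sqrt lambda) <= 4.
  by apply: le_trans qz; rewrite ler_wpM2l ?(ltW q0) // ltW.
have h0 : 0 <= q * (6 * expR 1 * Num.sqrt lambda) by rewrite !mulr_ge0 // ltW.
rewrite -s2; set s := Num.sqrt lambda in h h0 *; set e := expR 1 in h h0 *.
have : (q * (6 * e * s)) ^+ 2 <= 4 ^+ 2 by rewrite lerXn2r ?nnegrE.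
rewrite (_ : (q * (6 * e * s)) ^+ 2 = 18 * (q * e * (2 * s ^+ 2 * q) * e)); last by ring.
lra.
Qed.

End Counting.

(** * One step of the jump chain as an averaged toppling *)

Section Comparison.
Variables (R : realType) (lambda : R) (n : nat).
Hypothesis lambda_gt0 : 0 < lambda.
Implicit Types (eta : config n).

(** A finite list carrying all the mass of [next_prob lambda eta], so that expectations are finite
    sums. [eta] itself accounts for absorption, and duplicates are removed because distinct moves
    may lead to the same state. *)
Definition successors eta : seq (config n) :=
  undup (eta :: [seq sleep_at x eta | x <- enum 'I_n] ++
    [seq jump x (ordS x) eta | x <- enum 'I_n] ++
    [seq jump x (ord_pred x) eta | x <- enum 'I_n]).

Lemma sum_eq_seq (T : eqType) (r : seq T) a (f : T -> R) : uniq r -> a \in r ->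
  \sum_(b <- r) (b == a)%:R * f b = f a.
Proof.
move=> ur ar; rewrite (bigD1_seq a) //= eqxx mul1r big1 ?addr0 // => b ba.
by rewrite (negbTE ba) mul0r.
Qed.

Definition mean_ring (f : config n -> R) eta x : R :=
  lambda / (1 + lambda) * f (sleep_at x eta) +
  2^-1 * (1 + lambda)^-1 * f (jump x (ordS x) eta) +
  2^-1 * (1 + lambda)^-1 * f (jump x (ord_pred x) eta).

Lemma sum_next_prob f eta :
  \sum_(eta' <- successors eta) next_prob lambda eta eta' * f eta' =
  if total_rate lambda eta == 0 then f eta
  else \sum_x clock_rate lambda eta x / total_rate lambda eta * mean_ring f eta x.
Proof.
have us : uniq (successors eta) := undup_uniq _.
rewrite /next_prob; case: ifP => t0.
  by rewrite sum_eq_seq // mem_undup inE eqxx.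
under eq_bigr => eta' _ do rewrite mulr_suml.
rewrite exchange_big /=; apply: eq_bigr => x _.
under eq_bigr => eta' _ do
  rewrite -mulrA /ring_prob !mulrDl -!(mulrA _ (_ == _)%:R).
rewrite -mulr_sumr !big_split /= -!mulr_sumr !sum_eq_seq //.
all: rewrite mem_undup inE !mem_cat; apply/orP; right; apply/or3P.
- by apply: Or33; apply/mapP; exists x; rewrite ?mem_enum.
- by apply: Or32; apply/mapP; exists x; rewrite ?mem_enum.
- by apply: Or31; apply/mapP; exists x; rewrite ?mem_enum.
Qed.

Lemma clock_rate_ge0 eta x : 0 <= clock_rate lambda eta x.
Proof. by rewrite mulr_ge0 // addr_ge0 // ltW. Qed.

Lemma total_rate_ge0 eta : 0 <= total_rate lambda eta.
Proof. by apply: sumr_ge0 => x _; exact: clock_rate_ge0. Qed.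

Lemma next_prob_ge0 eta eta' : 0 <= next_prob lambda eta eta'.
Proof.
rewrite /next_prob; case: ifP => _; first exact: ler0n.
apply: sumr_ge0 => x _; rewrite mulr_ge0 ?divr_ge0 ?clock_rate_ge0 ?total_rate_ge0 //.
have l1 : 0 <= 1 + lambda by rewrite addr_ge0 // ltW.
by rewrite /ring_prob !addr_ge0 // mulr_ge0 // ?mulr_ge0 ?invr_ge0 // ltW.
Qed.

Lemma sum_next_prob1 eta :
  \sum_(eta' <- successors eta) next_prob lambda eta eta' = 1.
Proof.
have := sum_next_prob (fun=> 1) eta.
under eq_bigr do rewrite mulr1.
move=> ->; case: ifPn => // t0.
under eq_bigr => x _.
  rewrite /mean_ring !mulr1 (_ : _ + _ + _ = 1) ?mulr1; first over.
  by field; rewrite gt_eqF // addr_gt0.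
by rewrite -mulr_suml mulfV.
Qed.

Variable A : {set 'I_n}.

(* Since attempts to sleep outside A are ignored in [settle_prob], sleeping
   walks outside A are to be regarded as active. *)
Definition wake eta : config n :=
  [ffun x => if (x \notin A) && (eta x == None) then Some 1%N else eta x].

Lemma wake_sleep_at x eta : wake (sleep_at x eta) = topple A None x (wake eta).
Proof.
apply/ffunP => z; rewrite /= [LHS]ffunE sleep_atE.
case: (boolP (x \in A)) => xA; rewrite ?sleep_atE ffunE.
  by have [->|//] := eqVneq z x; rewrite xA.
have [->|//] := eqVneq z x; rewrite xA /=.
by rewrite /try_sleep; case: (eta x) => [[|[|k]]|].
Qed.

Lemma wake_jump x y eta : awake eta x -> wake (jump x y eta) = jump x y (wake eta).
Proof.
move=> /awakeP[k ek]; apply/ffunP => z; rewrite /= ffunE !jumpE /= ffunE.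
have [->|zx] := eqVneq z x; first by rewrite ek /= andbF; case: (x == y) => /=; rewrite ?andbF.
have [_|_] := eqVneq z y => //.
by case: (eta z) => [l|] /=; rewrite ?andbF // andbT; case: ifP.
Qed.

Lemma awake_wake eta x : awake eta x -> awake (wake eta) x.
Proof. by move=> /awakeP[k ek]; rewrite /awake ffunE ek andbF. Qed.

(** By the abelian property the mean after a ring is the same at every awake site, so averaging over
    the site that rings changes nothing. Only the absorbed case is a true inequality, by
    monotonicity in k. *)
Lemma next_settle_prob k eta :
  \sum_(eta' <- successors eta)
    next_prob lambda eta eta' * settle_prob lambda A k (wake eta') <=
  settle_prob lambda A k.+1 (wake eta).
Proof.
rewrite (sum_next_prob (fun e => settle_prob lambda A k (wake e))).
case: ifPn => t0; first exact: settle_prob_nondecreasing.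
rewrite le_eqVlt; apply/orP; left; apply/eqP.
rewrite (eq_bigr (fun x => clock_rate lambda eta x / total_rate lambda eta *
  settle_prob lambda A k.+1 (wake eta))).
  by rewrite -!mulr_suml mulfV // mul1r.
move=> x _; have [ax|nax] := boolP (awake eta x); last first.
  move: nax; rewrite /awake -eqn0Ngt /clock_rate => /eqP ->.
  by rewrite mulr0 !mul0r.
congr (_ * _); rewrite (settle_prob_topple A lambda_gt0 _ (awake_wake ax)).
by rewrite /mean_ring wake_sleep_at !wake_jump.
Qed.

End Comparison.

(** * Probabilities as real numbers *)

Local Open Scope classical_set_scope.
Local Open Scope ring_scope.

Section RealProbability.
Context (R : realType) d (Omega : measurableType d) (P : probability Omega R).
Implicit Types (E F : set Omega).

Definition pr E : R := fine (P E).

Lemma prE E : measurable E -> P E = (pr E)%:E.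
Proof. by move=> mE; rewrite /pr fineK // fin_num_measure. Qed.

Lemma pr_ge0 E : 0 <= pr E.
Proof. exact: fine_ge0. Qed.

Lemma pr_set0 : pr set0 = 0.
Proof. by rewrite /pr measure0. Qed.

Lemma pr_le E F : measurable E -> measurable F -> E `<=` F -> pr E <= pr F.
Proof.
by move=> mE mF EF; rewrite -lee_fin -!prE // le_measure // inE.
Qed.

Lemma pr_setU E F : measurable E -> measurable F -> E `&` F = set0 ->
  pr (E `|` F) = pr E + pr F.
Proof.
move=> mE mF EF; apply: EFin_inj.
by rewrite EFinD -!prE //; [exact: measureU | exact: measurableU].
Qed.

Lemma pr_setID E F : measurable E -> measurable F ->
  pr E = pr (E `&` F) + pr (E `\` F).
Proof.
move=> mE mF; rewrite -pr_setU; first by rewrite setUIDK.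
- exact: measurableI.
- exact: measurableD.
- by apply/seteqP; split=> x //= [[_ ?] []].
Qed.

Lemma pr_setU_le E F : measurable E -> measurable F -> pr (E `|` F) <= pr E + pr F.
Proof.
move=> mE mF; rewrite -lee_fin EFinD -!prE //; last exact: measurableU.
exact: measureU2.
Qed.

Lemma pr_le_sum (I : eqType) (r : seq I) E (F : I -> set Omega) :
  measurable E -> (forall i, measurable (F i)) ->
  (forall x, E x -> exists2 i, i \in r & F i x) -> pr E <= \sum_(i <- r) pr (F i).
Proof.
move=> mE mF; elim: r E mE => [|i r IH] E mE h.
  rewrite big_nil (_ : E = set0) ?pr_set0 //.
  by apply/seteqP; split=> x // /h[].
rewrite big_cons (pr_setID mE (mF i)) lerD //.
  by apply: pr_le => //; exact: measurableI.
apply: IH; first exact: measurableD.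
move=> x [/h[j]]; rewrite inE => /predU1P[->//|jr] Fj _; by exists j.
Qed.

Lemma measurable_mem_seq (I : choiceType) (r : seq I) (X : Omega -> I) :
  (forall i, measurable [set x | X x = i]) -> measurable [set x | X x \in r].
Proof.
move=> mX; rewrite (_ : [set x | _] = \big[setU/set0]_(i <- r) [set x | X x = i]).
  exact: bigsetU_measurable.
rewrite -bigcup_seq; apply/seteqP; split=> x /=; first by move=> xr; exists (X x).
by case=> i /= ir ->.
Qed.

Lemma pr_sum_disjoint (I : choiceType) (r : seq I) E (X : Omega -> I) :
  uniq r -> measurable E -> (forall i, measurable [set x | X x = i]) ->
  pr (E `&` [set x | X x \in r]) = \sum_(i <- r) pr (E `&` [set x | X x = i]).
Proof.
move=> + mE mX; elim: r => [|i r IH] /=.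
  by move=> _; rewrite big_nil (_ : _ `&` _ = set0) ?pr_set0 //; apply/seteqP; split => x // [].
move=> /andP[ir ur]; rewrite big_cons -IH //.
have mr : measurable [set x | X x \in r] by exact: measurable_mem_seq.
rewrite -pr_setU; [|exact: measurableI|exact: measurableI|].
  congr pr; rewrite -setIUr; congr (_ `&` _); apply/seteqP; split=> x /=.
    by rewrite inE => /predU1P.
  by rewrite inE => -[->|->]; rewrite ?eqxx ?orbT.
by apply/seteqP; split => x //= -[[_ Xi] [_]]; rewrite Xi (negbTE ir).
Qed.

Lemma measurable_exists (T : countType) (F : T -> set Omega) :
  (forall s, measurable (F s)) -> measurable [set x | exists s, F s x].
Proof.
move=> mF; pose G k : set Omega := if pickle_inv k is Some s then F s else set0.
rewrite (_ : [set _ | _] = \bigcup_k G k).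
  by apply: bigcup_measurable => k _; rewrite /G; case: pickle_inv.
apply/seteqP; split => x /=; rewrite /G.
  by move=> [s Fs]; exists (pickle s); rewrite ?pickleK_inv.
by move=> [k _]; case: pickle_inv => // s Fs; exists s.
Qed.

(** Total probability over the values of X. The pieces are indexed by their codes, and a code of no
    value gives the empty piece. *)
Lemma pr_partition_le (S : countType) (X : Omega -> S) E c :
  measurable E -> (forall s, measurable [set x | X x = s]) ->
  (forall s, pr (E `&` [set x | X x = s]) <= c * pr [set x | X x = s]) ->
  0 <= c -> pr E <= c.
Proof.
move=> mE mX h c0.
pose F k : set Omega := if pickle_inv k is Some s then [set x | X x = s] else set0.
have mF k : measurable (F k) by rewrite /F; case: pickle_inv.
have tF : trivIset setT F.
  apply/trivIsetP => i j _ _ ij; apply/seteqP; split => x // -[].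
  have := @pickle_invK S i; have := @pickle_invK S j; rewrite /F /=.
  case: pickle_inv => //= s ej; case: pickle_inv => //= t ei Xt Xs.
  by move: ij; rewrite -ei -ej -Xt -Xs eqxx.
have UF : \bigcup_k F k = setT.
  apply/seteqP; split => // x _; exists (pickle (X x)) => //.
  by rewrite /F pickleK_inv.
have cov : (P E = \sum_(0 <= k <oo) P (E `&` F k))%E.
  rewrite -measure_semi_bigcup.
  - by rewrite -setI_bigcupr UF setIT.
  - by move=> k; exact: measurableI.
  - by apply: trivIset_setIl.
  - by apply: bigcup_measurable => k _; exact: measurableI.
rewrite -lee_fin -prE // cov.
apply: (@le_trans _ _ (\sum_(0 <= k <oo) c%:E * P (F k))%E).
  apply: lee_nneseries => // k _.
  rewrite !prE ?lee_fin //; last exact: measurableI.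
  rewrite /F; case: pickle_inv => [s|]; first exact: h.
  by rewrite setI0 pr_set0 mulr0.
rewrite nneseriesZl // -measure_semi_bigcup //; last by rewrite UF.
by rewrite UF -[X in (_ * X)%E]/(P setT) probability_setT mule1.
Qed.

End RealProbability.

(** * The jump skeleton *)

Section Skeleton.
Context (R : realType) d (Omega : measurableType d) (P : probability Omega R).
Variables (S : countType) (rate : S -> R) (p : S -> S -> R).
Variables (Y : nat -> Omega -> S) (W : nat -> Omega -> \bar R).
Hypothesis YW : jump_skeleton P rate p Y W.

Let mY k s : measurable [set omega | Y k omega = s].
Proof. exact: jump_measurable_state YW k s. Qed.

Let mW k : measurable_fun setT (W k).
Proof. exact: jump_measurable_wait YW k. Qed.

Let W_gt0 k omega : (0 < W k omega)%E.
Proof. exact: jump_wait_gt0 YW k omega. Qed.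

Definition path_event m (s : nat -> S) : set Omega :=
  [set omega | forall i, (i <= m)%N -> Y i omega = s i].

Lemma path_event0 s : path_event 0 s = [set omega | Y 0%N omega = s 0%N].
Proof.
apply/seteqP; split => x /=; first exact.
by move=> h i; rewrite leqn0 => /eqP ->.
Qed.

Lemma path_eventS m s :
  path_event m.+1 s = path_event m s `&` [set omega | Y m.+1 omega = s m.+1].
Proof.
apply/seteqP; split => x /=; first by move=> h; split=> [i im|]; apply: h => //; exact: leqW.
by move=> [h h'] i; rewrite leq_eqVlt => /predU1P[->|/h].
Qed.

Lemma measurable_path_event m s : measurable (path_event m s).
Proof.
elim: m => [|m IH]; first by rewrite path_event0.
by rewrite path_eventS; exact: measurableI.
Qed.

Lemma eq_path_event m s s' : (forall i, (i <= m)%N -> s i = s' i) ->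
  path_event m s = path_event m s'.
Proof.
by move=> ss; apply/seteqP; split => x h i im; rewrite h // ss.
Qed.

Definition marked_event m (s : nat -> S) (t : nat -> R) (b : nat -> bool) :
  set Omega := path_event m s `&`
    [set omega | forall i, (i < m)%N -> ((t i)%:E < W i omega)%E = b i].

Lemma measurable_wait_gt k (c : R) : measurable [set omega | (c%:E < W k omega)%E].
Proof. by rewrite -[X in measurable X]setTI; exact: emeasurable_fun_o_infty. Qed.

Lemma measurable_marked_event m s t b : measurable (marked_event m s t b).
Proof.
apply: measurableI; first exact: measurable_path_event.
elim: m => [|m IH].
  rewrite (_ : [set _ | _] = setT) //; exact/seteqP.
have -> : [set omega | forall i, (i < m.+1)%N -> ((t i)%:E < W i omega)%E = b i] =
    [set omega | forall i, (i < m)%N -> ((t i)%:E < W i omega)%E = b i] `&`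
    [set omega | ((t m)%:E < W m omega)%E = b m].
  apply/seteqP; split => x /=.
    by move=> h; split=> [i im|]; apply: h; rewrite // ltnS ltnW.
  by move=> [h h'] i; rewrite ltnS leq_eqVlt => /predU1P[->|/h].
apply: measurableI => //; case: (b m); first exact: measurable_wait_gt.
rewrite (_ : [set _ | _] = ~` [set omega | ((t m)%:E < W m omega)%E]).
  by apply: measurableC; exact: measurable_wait_gt.
by apply/seteqP; split => x /= => [-> //|/negP/negbTE].
Qed.

Local Notation Pr := (pr P).
Let start (s : nat -> S) := Pr [set omega | Y 0%N omega = s 0%N].

(** [jump_law] is the case where all marks are true. False marks are introduced one at a time by
    taking differences; the induction is on an index j from which on all marks are true. *)
Lemma pr_marked_event m s t b : (forall i, 0 <= t i) ->
  Pr (marked_event m s t b) = start s * \prod_(i < m)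
    ((if b i then expR (- (rate (s i) * t i)) else 1 - expR (- (rate (s i) * t i)))
      * p (s i) (s i.+1)).
Proof.
suff H j : forall (t : nat -> R) (b : nat -> bool), (forall i, 0 <= t i) -> (forall i, (j <= i < m)%N -> b i) ->
    Pr (marked_event m s t b) = start s * \prod_(i < m)
    ((if b i then expR (- (rate (s i) * t i)) else 1 - expR (- (rate (s i) * t i)))
      * p (s i) (s i.+1)).
  by move=> t0; apply: (H m) => // i; lia.
elim: j => [|j IH] {}t {}b t0 hb.
  apply: EFin_inj; rewrite -prE; last exact: measurable_marked_event.
  rewrite EFinM -prE //.
  have -> : marked_event m s t b = [set omega |
      (forall i, (i <= m)%N -> Y i omega = s i) /\
      (forall i, (i < m)%N -> ((t i)%:E < W i omega)%E)].
    by apply/seteqP; split => x [h h']; split => // i im; move: (h' i im); rewrite hb.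
  rewrite (jump_law YW) //; congr (_ * _%:E)%E.
  by apply: eq_bigr => i _; rewrite hb /= ?ltn_ord.
have [bj|bj] := boolP (b j).
  apply: IH => // i /andP[ji im]; have [<-//|nij] := eqVneq j i.
  by apply: hb; rewrite im ltn_neqAle nij ji.
have [mj|jm] := leqP m j.
  by apply: IH => // i; lia.
pose b' i := (i == j) || b i.
(* Threshold 0 at j is no constraint, as waiting times are positive; so the event with a false mark
   at j is the difference of two events with a true one. *)
pose t' i := if i == j then 0 else t i.
have hb' i : (j <= i < m)%N -> b' i.
  rewrite /b'; case: eqP => //= ij im; apply: hb; lia.
have t0' i : 0 <= t' i by rewrite /t'; case: ifP.
have e1 := IH t b' t0 hb'; have e2 := IH t' b' t0' hb'.
have -> : Pr (marked_event m s t b) =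
    Pr (marked_event m s t' b') - Pr (marked_event m s t b').
  have -> : marked_event m s t b = marked_event m s t' b' `\` marked_event m s t b'.
    apply/seteqP; split => x.
      move=> [hp hw]; split; last first.
        by move=> [_ /(_ _ jm)]; rewrite hw // /b' eqxx (negbTE bj).
      split=> // i im; rewrite /t' /b'; case: eqP => /= [_|_]; last exact: hw.
      exact: W_gt0.
    move=> [[hp hw] nh]; split=> // i im; have [->|ij] := eqVneq i j; last first.
      by have := hw i im; rewrite /t' /b' (negbTE ij).
    rewrite (negbTE bj); apply/negbTE/negP => hj; apply: nh; split => // k km.
    rewrite /b'; have [->|kj] := eqVneq k j; first by rewrite hj.
    by have := hw k km; rewrite /t' /b' (negbTE kj).
  have mm := measurable_marked_event; rewrite [in RHS](pr_setID P (mm _ _ _ _) (mm m s t b')).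
  rewrite (_ : marked_event m s t' b' `&` _ = marked_event m s t b').
    by rewrite addrAC subrr add0r.
  apply/seteqP; split => x [] // hp hw; split=> //; split => // i im.
  rewrite /t' /b'; case: eqP => /= [_|/eqP/negbTE ij]; first exact: W_gt0.
  by rewrite hw // /b' ij.
rewrite e1 e2 -mulrBr; congr (_ * _).
have D (F : 'I_m -> R) : \prod_(i < m) F i =
    F (Ordinal jm) * \prod_(i < m | i != Ordinal jm) F i by rewrite (bigD1 (Ordinal jm)).
rewrite !D /= /b' /t' eqxx (negbTE bj) /= mulr0 oppr0 expR0.
rewrite mulrBl mul1r mulrBl; congr (_ * _ - _ * _).
  apply: eq_bigr => i ij; have {}ij : (i == j :> nat) = false by exact/negbTE.
  by rewrite ij.
apply: eq_bigr => i ij; have {}ij : (i == j :> nat) = false by exact/negbTE.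
by rewrite ij.
Qed.

Lemma pr_path_event m s :
  Pr (path_event m s) = start s * \prod_(i < m) p (s i) (s i.+1).
Proof.
have := @pr_marked_event m s (fun=> 0) (fun=> true) (fun=> lexx 0).
rewrite (_ : marked_event _ _ _ _ = path_event m s).
  by move=> ->; congr (_ * _); apply: eq_bigr => i _; rewrite mulr0 oppr0 expR0 mul1r.
by apply/seteqP; split => x; [case|move=> h; split => // i _; exact: W_gt0].
Qed.

(** * Hitting probabilities of the chain *)

Section Hitting.
Variables (succ : S -> seq S) (h : nat -> S -> R) (a : S) (K : nat).
Hypothesis succ_uniq : forall s, uniq (succ s).
Hypothesis p_succ : forall s, \sum_(s' <- succ s) p s s' = 1.
Hypothesis h_ge0 : forall k s, 0 <= h k s.
Hypothesis h0 : h 0%N a = 1.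
Hypothesis hS : forall k s, \sum_(s' <- succ s) p s s' * h k s' <= h k.+1 s.

(** Induction on the number k of steps left: given the path up to time i, the next state lies almost
    surely in [succ (s i)], and [hS] averages the bounds at these states. *)
Lemma pr_hit_path k i s : (i + k = K)%N ->
  Pr (path_event i s `&` [set omega | Y K omega = a]) <= Pr (path_event i s) * h k (s i).
Proof.
elim: k i s => [|k IH] i s ik.
  have [sa|sa] := eqVneq (s i) a.
    rewrite sa h0 mulr1; apply: pr_le => //; last exact: measurable_path_event.
    by apply: measurableI => //; exact: measurable_path_event.
  rewrite (_ : _ `&` _ = set0) ?pr_set0 ?mulr_ge0 ?pr_ge0 //.
  apply/seteqP; split => x // [hp Ka]; move: sa; rewrite -(hp i) //.
  by move: ik; rewrite addn0 => ->; rewrite Ka eqxx.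
pose ext s' j := if (j <= i)%N then s j else s'.
have ext_event s' : path_event i s `&` [set omega | Y i.+1 omega = s'] = path_event i.+1 (ext s').
  rewrite path_eventS /ext ltnn; congr (_ `&` _).
  by apply: eq_path_event => j ->.
have pr_ext s' : Pr (path_event i.+1 (ext s')) = Pr (path_event i s) * p (s i) s'.
  rewrite !pr_path_event big_ord_recr /= /ext leqnn ltnn -mulrA; congr (_ * (_ * _)).
  by apply: eq_bigr => j _; rewrite (ltnW (ltn_ord j)) ltn_ord.
have mp := measurable_path_event.
have mr : measurable (path_event i s `&` [set x | Y i.+1 x \in succ (s i)]).
  by apply: measurableI => //; exact: measurable_mem_seq.
have full : Pr (path_event i s `&` [set x | Y i.+1 x \in succ (s i)]) = Pr (path_event i s).
  rewrite pr_sum_disjoint //.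
  under eq_bigr do rewrite ext_event pr_ext.
  by rewrite -mulr_sumr p_succ mulr1.
have null : Pr (path_event i s `\` (path_event i s `&` [set x | Y i.+1 x \in succ (s i)])) = 0.
  have := pr_setID P (mp i s) mr; rewrite setIA setIid full; lra.
have mK : measurable (path_event i s `&` [set omega | Y K omega = a]) by exact: measurableI.
rewrite (pr_setID P mK mr) -[leRHS]addr0 lerD //; last first.
  rewrite -null; apply: pr_le; [exact: measurableD|exact: measurableD|].
  by move=> x [[hp _] nh].
pose F s' := path_event i.+1 (ext s') `&` [set omega | Y K omega = a].
apply: (@le_trans _ _ (\sum_(s' <- succ (s i)) Pr (F s'))).
  apply: pr_le_sum; [exact: measurableI|by move=> s'; exact: measurableI|].
  move=> x [[hp Ka] [_ /= sx]]; exists (Y i.+1 x) => //; split => //.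
  by rewrite -ext_event.
apply: le_trans (_ : \sum_(s' <- succ (s i)) Pr (path_event i s) * (p (s i) s' * h k s') <= _).
  apply: ler_sum => s' _; rewrite mulrA -pr_ext.
  have := IH i.+1 (ext s'); rewrite /ext ltnn; apply; by rewrite addSnnS.
by rewrite -mulr_sumr ler_wpM2l ?pr_ge0.
Qed.

Lemma pr_hit s0 :
  Pr ([set omega | Y 0%N omega = s0] `&` [set omega | Y K omega = a]) <=
  Pr [set omega | Y 0%N omega = s0] * h K s0.
Proof.
have := @pr_hit_path K 0 (fun=> s0) (add0n _).
by rewrite path_event0.
Qed.

End Hitting.

(** * Long waits among the first K rings *)

Section Marks.
Variables (good : pred S) (t : S -> R) (q : R) (K M : nat).
Hypothesis t_ge0 : forall s, 0 <= t s.
Hypothesis q01 : 0 <= q <= 1.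
Hypothesis t_q : forall s, good s -> expR (- (rate s * t s)) = q.
Hypothesis p_ge0 : forall s s', 0 <= p s s'.

Definition marks omega : nat :=
  (\sum_(i < K) ((t (Y i omega))%:E < W i omega)%E)%N.

Definition few_marks : set Omega :=
  [set omega | (forall i, (i < K)%N -> good (Y i omega)) /\ (marks omega < M)%N].

Let path_ext (f : {ffun 'I_K.+1 -> S}) (i : nat) : S := f (inord i).

Let path_of omega : {ffun 'I_K.+1 -> S} := [ffun i : 'I_K.+1 => Y i omega].

Let path_of_event f : [set omega | path_of omega = f] = path_event K (path_ext f).
Proof.
apply/seteqP; split => x /=; rewrite /path_ext /path_of.
  by move=> <- i iK; rewrite ffunE inordK.
move=> h; apply/ffunP => i; rewrite ffunE h ?inord_val //.
by rewrite -ltnS.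
Qed.

Let mark_seq (b : {ffun 'I_K -> bool}) (i : nat) : bool :=
  if insub i is Some j then b j else true.

Let mark_seq_ord b (i : 'I_K) : mark_seq b i = b i.
Proof. by rewrite /mark_seq valK. Qed.

(** The event is a countable union of marked events, over paths of length K and patterns of
    marks. *)
Lemma measurable_few_marks : measurable few_marks.
Proof.
pose F (fb : {ffun 'I_K.+1 -> S} * {ffun 'I_K -> bool}) : set Omega :=
  if [forall i : 'I_K, good (path_ext fb.1 i)] && (\sum_(i < K) fb.2 i < M)%N
  then marked_event K (path_ext fb.1) (fun i => t (path_ext fb.1 i)) (mark_seq fb.2)
  else set0.
rewrite (_ : few_marks = [set omega | exists fb, F fb omega]).
  apply: measurable_exists => fb; rewrite /F.
  by case: ifP => // _; exact: measurable_marked_event.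
apply/seteqP; split => x.
  move=> [gx lM]; have hp : path_event K (path_ext (path_of x)) x.
    by rewrite -path_of_event.
  exists (path_of x, [ffun i : 'I_K => ((t (Y i x))%:E < W i x)%E]); rewrite /F /= ifT.
    split=> // i iK; rewrite /mark_seq insubT /= ffunE -hp //; exact: ltnW.
  apply/andP; split; first by apply/forallP => i; rewrite -hp ?gx // ltnW.
  by apply: leq_ltn_trans lM; apply: leq_sum => i _; rewrite ffunE.
move=> [[f b]]; rewrite /F /=; case: ifP => // /andP[/forallP gf bM] [hp hw].
split=> [i iK|]; first by rewrite hp ?(gf (Ordinal iK)) // ltnW.
apply: leq_ltn_trans bM; apply: leq_sum => i _.
by rewrite hp ?(ltnW (ltn_ord i)) // hw // mark_seq_ord.
Qed.

(* Chernoff's bound: the mean of [2 ^- marks] is [(1 - q / 2) ^ K]. *)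
Lemma pr_few_marks : Pr few_marks <= 2 ^+ M * (1 - q / 2) ^+ K.
Proof.
have mE := measurable_few_marks; have /andP[q0 q1] := q01.
have c0 : 0 <= 2 ^+ M * (1 - q / 2) ^+ K by rewrite mulr_ge0 ?exprn_ge0 //; lra.
apply: (@pr_partition_le _ _ _ _ _ path_of) => // f; rewrite path_of_event.
  exact: measurable_path_event.
set s := path_ext f.
have mp := measurable_path_event.
have [gs|ngs] := boolP [forall i : 'I_K, good (s i)]; last first.
  rewrite (_ : _ `&` _ = set0) ?pr_set0; first exact: mulr_ge0 c0 (pr_ge0 _ _).
  apply/seteqP; split => x // [[gx _] hp]; case/negP: ngs; apply/forallP => i.
  by rewrite -hp ?gx // ltnW.
pose ts i := t (s i).
pose F (b : {ffun 'I_K -> bool}) : set Omega := if (\sum_(i < K) b i < M)%N then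
  marked_event K s ts (mark_seq b) else set0.
have mF b : measurable (F b).
  by rewrite /F; case: ifP => // _; exact: measurable_marked_event.
apply: (@le_trans _ _ (\sum_(b : {ffun 'I_K -> bool}) Pr (F b))).
  apply: pr_le_sum => //; first exact: measurableI.
  move=> x [[_ lM] hp].
  exists [ffun i : 'I_K => ((ts i)%:E < W i x)%E]; first by rewrite mem_index_enum.
  rewrite /F ifT; last first.
    apply: leq_ltn_trans lM; apply: leq_sum => i _; rewrite ffunE hp // ltnW //.
  split=> // i iK; rewrite /mark_seq insubT /= ffunE //.
(* On [F b] fewer than M marks are set, so [2 ^+ M] pays for halving q at each of them. *)
have bound (b : {ffun 'I_K -> bool}) : Pr (F b) <= 2 ^+ M * (Pr (path_event K s) *
    \prod_(i < K) (if b i then q / 2 else 1 - q)).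
  have P0 : 0 <= \prod_(i < K) (if b i then q / 2 else 1 - q).
    by apply: prodr_ge0 => i _; case: ifP; lra.
  rewrite /F; case: ifP => [bM|_]; last by rewrite pr_set0 !mulr_ge0 ?pr_ge0 // exprn_ge0.
  rewrite pr_marked_event => [|i]; last exact: t_ge0.
  rewrite pr_path_event mulrCA -[leRHS]mulrA ler_wpM2l ?pr_ge0 //.
  rewrite big_split /= [leLHS]mulrC ler_wpM2l //; first exact: prodr_ge0.
  rewrite (eq_bigr (fun i => (if b i then 2 else 1) * (if b i then q / 2 else 1 - q))); last first.
    move=> i _; rewrite mark_seq_ord /ts t_q; last exact: (forallP gs).
    by case: ifP => _; lra.
  rewrite big_split /= ler_wpM2r //.
  rewrite (eq_bigr (fun i => 2 ^+ (b i))); last by move=> i _; case: (b i).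
  by rewrite prodrXr ler_weXn2l ?ler1n // ltnW.
apply: le_trans (ler_sum _ (fun b _ => bound b)) _.
rewrite -!mulr_sumr mulrCA -[leRHS]mulrC ler_wpM2l ?pr_ge0 // ler_wpM2l ?exprn_ge0 //.
rewrite -(bigA_distr_bigA (fun (i : 'I_K) (c : bool) => if c then q / 2 else 1 - q)) /=.
under eq_bigr do rewrite big_bool /=.
rewrite prodr_const card_ord le_eqVlt (_ : q / 2 + (1 - q) = 1 - q / 2) ?eqxx //; lra.
Qed.

End Marks.

End Skeleton.

(** * Total activity *)

Section HoldingTimes.
Variables (R : realType) (w : nat -> \bar R).
Hypothesis w_gt0 : forall k, (0 < w k)%E.

Definition jump_time (k : nat) : \bar R := (\sum_(i < k) w i)%E.

(* The length of [[jump_time k, jump_time k.+1[], which is empty when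
   [jump_time k] is infinite; the maximum discards [+oo - +oo = -oo]. *)
Definition holding_time (k : nat) : \bar R :=
  maxe 0%E (jump_time k.+1 - jump_time k)%E.

Definition holding_set (k : nat) : set R :=
  [set t | (jump_time k <= t%:E < jump_time k.+1)%E].

Lemma jump_timeS k : jump_time k.+1 = (jump_time k + w k)%E.
Proof. by rewrite /jump_time big_ord_recr. Qed.

Lemma jump_time_ge0 k : (0 <= jump_time k)%E.
Proof. by apply: sume_ge0 => i _; exact: ltW. Qed.

Lemma jump_time_le j k : (j <= k)%N -> (jump_time j <= jump_time k)%E.
Proof.
move=> /subnKC <-; elim: (k - j)%N => [|i IH]; first by rewrite addn0.
apply: le_trans IH _; rewrite addnS jump_timeS -[leLHS]adde0.
by apply: leeD2l; exact: ltW.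
Qed.

Lemma holding_time_ge0 k : (0 <= holding_time k)%E.
Proof. by rewrite /holding_time le_max lexx. Qed.

Lemma holding_set_itv k :
  holding_set k = set0 /\ holding_time k = 0%E \/
  exists i : interval R, holding_set k = [set` i] /\
    lebesgue_measure [set` i] = holding_time k.
Proof.
have := jump_time_ge0 k; have := jump_time_le (leqnSn k).
have := w_gt0 k; have := jump_timeS k; rewrite /holding_set /holding_time.
case: (jump_time k) => [a||] //; last first.
  move=> + wk _ _; rewrite addye; last by rewrite gt_eqF // (lt_trans _ wk) // ltNy0.
  move=> ->; left; split.
    by apply/seteqP; split => x //=; rewrite leye_eq.
  by rewrite max_l //= leNye.
move=> + wk ab a0; case: (w k) wk => [b||] // b0 e; rewrite e in ab *; right.
  exists `[a, a + b[; split.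
    by apply/seteqP; split => x /=; rewrite in_itv /= lee_fin lte_fin.
  rewrite lebesgue_measure_itv /= lte_fin ltrDl -lte_fin b0 max_r //.
  by rewrite -EFinB lee_fin addrAC subrr add0r -lee_fin ltW.
exists `[a, +oo[; split.
  by apply/seteqP; split => x /=; rewrite in_itv /= lee_fin andbT ?ltry ?andbT.
by rewrite lebesgue_measure_itv /= ltry max_r // addye // leey.
Qed.

Lemma measurable_holding_set k : measurable (holding_set k).
Proof. by case: (holding_set_itv k) => [[-> _]//|[i [-> _]]]; exact: measurable_itv. Qed.

Lemma lebesgue_holding_set k : lebesgue_measure (holding_set k) = holding_time k.
Proof. by case: (holding_set_itv k) => [[-> ->]|[i [-> ->]]]; rewrite ?measure0. Qed.

Lemma trivIset_holding_set : trivIset setT holding_set.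
Proof.
apply/trivIsetP => i j _ _; wlog ij : i j / (i < j)%N.
  move=> H; rewrite neq_ltn => /orP[h|h]; first by apply: H; rewrite // neq_ltn h.
  by rewrite setIC; apply: H; rewrite // neq_ltn h.
move=> _; apply/seteqP; split => t //= [/andP[_ ti] /andP[jt _]].
by have := le_lt_trans (le_trans (jump_time_le ij) jt) ti; rewrite ltxx.
Qed.

(** The second hypothesis, absence of explosion, makes the disjoint holding sets cover the
    half-line, and f is constant on each of them. *)
Lemma integral_step (f : R -> R) (y : nat -> R) : (forall k, 0 <= y k) ->
  (forall t, 0 <= t -> exists k, holding_set k t /\ f t = y k) ->
  (\int[lebesgue_measure]_(t in `[0%R, +oo[) (f t)%:E =
   \sum_(0 <= k <oo) (y k)%:E * holding_time k)%E.
Proof.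
move=> y0 fy.
have cov : [set` `[0%R, +oo[] = \bigcup_k holding_set k.
  apply/seteqP; split => t /=; rewrite in_itv /= andbT.
    by move=> /fy[k [hk _]]; exists k.
  by move=> [k _ /andP[kt _]]; rewrite -lee_fin (le_trans (jump_time_ge0 k)).
have fE k t : holding_set k t -> f t = y k.
  move=> kt; have t0 : 0 <= t.
    by case/andP: kt => kt _; rewrite -lee_fin (le_trans (jump_time_ge0 k)).
  have [j [jt ->]] := fy t t0.
  have [->//|jk] := eqVneq j k.
  have := trivIset_holding_set; move/trivIsetP/(_ j k I I jk)/seteqP => [/(_ t)].
  by move=> h _; case: h.
have mf : measurable_fun (\bigcup_k holding_set k) (fun t => (f t)%:E).
  apply/measurable_fun_bigcup => k; first exact: measurable_holding_set.
  have mc : measurable_fun (holding_set k) (cst (y k)%:E) by exact: measurable_cst.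
  by apply: eq_measurable_fun mc => t; rewrite inE => /fE ->.
rewrite cov ge0_integral_bigcup //; first last.
- exact: trivIset_holding_set.
- by move=> t [k _ /fE ->]; rewrite lee_fin.
- exact: measurable_holding_set.
apply: eq_eseriesr => k _.
transitivity (\int[lebesgue_measure]_(t in holding_set k) cst (y k)%:E t)%E.
  by apply: eq_integral => t; rewrite inE => /fE ->.
by rewrite -lebesgue_holding_set; apply: integral_cst; exact: measurable_holding_set.
Qed.

(** A marked index contributes [N i * w i > 1] as long as the jump times stay finite; the first
    infinite wait makes the whole sum infinite, since [N i > 0]. *)
Lemma sum_holding_time_ge (N : nat -> nat) (m : nat -> bool) K :
  (forall i, (i < K)%N -> (0 < N i)%N) ->
  (forall i, (i < K)%N -> m i -> (((N i)%:R^-1)%:E < w i)%E) ->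
  ((\sum_(i < K) m i)%:R%:E <=
   \sum_(i < K) (N i)%:R%:E * holding_time i :> \bar R)%E.
Proof.
move=> N0 hm.
suff H j : (j <= K)%N -> jump_time j \is a fin_num /\
    ((\sum_(i < j) m i)%:R%:E <=
    \sum_(i < j) (N i)%:R%:E * holding_time i :> \bar R)%E \/
    (\sum_(i < j) (N i)%:R%:E * holding_time i = +oo :> \bar R)%E.
  by case: (H K (leqnn K)) => [[]//|->]; rewrite leey.
elim: j => [|j IH] jK; first by left; rewrite /jump_time !big_ord0.
have NW0 i : (0 <= (N i)%:R%:E * holding_time i :> \bar R)%E.
  by rewrite mule_ge0 ?holding_time_ge0 // lee_fin.
have Nj : 0 < (N j)%:R :> R by rewrite ltr0n N0.
rewrite !big_ord_recr jump_timeS /=; have [[rj IHj]|IHj] := IH (ltnW jK); last first.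
  right; rewrite IHj addye // gt_eqF // (lt_le_trans _ (NW0 j)) //.
have hE : holding_time j = w j.
  rewrite /holding_time jump_timeS addeAC subee // add0e max_r //; exact: ltW.
rewrite hE; have := w_gt0 j; have := hm j jK; case: (w j) => [b||] // hb b0.
  left; rewrite fin_numD rj; split=> //.
  rewrite natrD EFinD leeD // lee_fin; case: (m j) hb => // [/(_ isT)|_].
    by rewrite lte_fin -(ltr_pM2l Nj) mulfV ?gt_eqF // => /ltW.
  by rewrite mulr_ge0 //; rewrite ltW // -lte_fin.
right; rewrite gt0_muley ?lte_fin // addey // gt_eqF //.
apply: (lt_le_trans (ltNyr 0)); apply: sume_ge0 => i _; exact: NW0.
Qed.

End HoldingTimes.

(** * The activity as a sum over rings *)

Section Activity.
Context (R : realType) d (Omega : measurableType d) (P : probability Omega R).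
Variables (n : nat) (rate : config n -> R) (p : config n -> config n -> R).
Variables (eta : R -> Omega -> config n).
Variables (Y : nat -> Omega -> config n) (W : nat -> Omega -> \bar R).
Hypothesis YW : jump_skeleton P rate p Y W.
Hypothesis etaE : forall t omega, 0 <= t -> exists k : nat,
  (ring_time W k omega <= t%:E < ring_time W k.+1 omega)%E /\
  eta t omega = Y k omega.

Let W_gt0 k omega : (0 < W k omega)%E.
Proof. exact: jump_wait_gt0 YW k omega. Qed.

Let D k omega := holding_time (W ^~ omega) k.

Lemma total_activityE omega : total_activity eta omega =
  (\sum_(x < n) \sum_(0 <= k <oo) (nactive (Y k omega x))%:R%:E * D k omega)%E.
Proof.
apply: eq_bigr => x _.
rewrite -(@integral_step R (W ^~ omega) _ (fun t => (nactive (eta t omega x))%:R)) //.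
by move=> t t0; have [k [kt ->]] := etaE omega t0; exists k.
Qed.

Lemma measurable_state (A : set (config n)) k : measurable [set omega | A (Y k omega)].
Proof.
rewrite (_ : [set _ | _] =
    [set omega | exists s, (if `[< A s >] then [set omega | Y k omega = s] else set0) omega]).
  apply: measurable_exists => s; case: ifP => // _.
  exact: jump_measurable_state YW k s.
apply/seteqP; split => x /=.
  by move=> AY; exists (Y k x); rewrite ifT //; exact/asboolP.
by move=> [s]; case: asboolP => // As ->.
Qed.

Lemma measurable_total_activity (c : \bar R) :
  measurable [set omega | (c <= total_activity eta omega)%E].
Proof.
rewrite -[X in measurable X]setTI; apply: emeasurable_fun_c_infty => //.
rewrite (_ : total_activity eta = fun omega => (\sum_(x < n) \sum_(0 <= k <oo)
    (nactive (Y k omega x))%:R%:E * D k omega)%E); last first.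
  by apply/funext => omega; rewrite total_activityE.
apply: emeasurable_sum => x.
apply: ge0_emeasurable_sum => [k omega _ _|k _].
  by rewrite mule_ge0 ?holding_time_ge0 // lee_fin.
apply: emeasurable_funM.
  apply/measurable_EFinP => _ B mB; rewrite setTI.
  exact: (measurable_state (fun s => B (nactive (s x))%:R)).
have mr j : measurable_fun setT (fun omega => jump_time (W ^~ omega) j).
  by apply: emeasurable_sum => i; exact: jump_measurable_wait YW i.
apply: measurable_maxe; first exact: measurable_cst.
exact: emeasurable_funB.
Qed.

Definition total_active (s : config n) : nat := (\sum_x nactive (s x))%N.

Lemma total_activity_ge_marks omega K :
  (forall i, (i < K)%N -> (0 < total_active (Y i omega))%N) ->
  ((marks Y W (fun s => (total_active s)%:R^-1) K omega)%:R%:E <=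
   total_activity eta omega)%E.
Proof.
move=> pos; rewrite total_activityE /marks.
have := @sum_holding_time_ge R (W ^~ omega) (W_gt0 ^~ omega)
  (fun i => total_active (Y i omega))
  (fun i => ((total_active (Y i omega))%:R^-1%:E < W i omega)%E) K pos (fun _ _ => id).
move=> h; apply: le_trans h _.
apply: (@le_trans _ _ (\sum_(x < n) \sum_(0 <= k < K)
    (nactive (Y k omega x))%:R%:E * D k omega)%E); last first.
  apply: lee_sum => x _; apply: nneseries_lim_ge => k _ _.
  by rewrite mule_ge0 ?holding_time_ge0 // lee_fin.
under [leRHS]eq_bigr do rewrite big_mkord.
rewrite exchange_big /=; apply: lee_sum => i _.
rewrite /total_active natr_sum -sumEFin ge0_sume_distrl //.
Qed.

End Activity.

(** * The initial configuration *)

Section PoissonStart.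
Context (R : realType) d (Omega : measurableType d) (P : probability Omega R).
Variables (n : nat) (zeta : R) (X : Omega -> config n).
Hypothesis zeta_gt0 : 0 < zeta.
Hypothesis mX : forall s, measurable [set omega | X omega = s].
Hypothesis X_poisson : iid_poisson P zeta X.

Lemma series_exp_coeff_le (x : R) L : 0 <= x -> series (exp_coeff x) L <= expR x.
Proof.
move=> x0; apply: nondecreasing_cvgn_le; last exact: is_cvg_series_exp_coeff.
apply/nondecreasing_seqP => k; rewrite /series /= big_nat_recr //= lerDl.
exact: exp_coeff_ge0.
Qed.

(** Truncation to fewer than L walks per site keeps the sums over initial configurations finite; L
    tends to infinity at the end. *)
Let occupied L (k : {ffun 'I_n -> 'I_L}) : config n := [ffun x => Some (k x : nat)].

Let occupied_inj L : injective (@occupied L).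
Proof.
move=> k l /ffunP kl; apply/ffunP => x; have := kl x; rewrite !ffunE => -[].
exact: val_inj.
Qed.

Let pr_occupied L (Q : pred {ffun 'I_n -> 'I_L}) :
  pr P [set omega | X omega \in [seq occupied k | k <- enum Q]] =
  \sum_(k | Q k) \prod_x poisson_pmf zeta (k x).
Proof.
have ur : uniq [seq occupied k | k <- enum Q].
  by rewrite map_inj_uniq ?enum_uniq //; exact: occupied_inj.
have := pr_sum_disjoint P ur measurableT mX; rewrite setTI => ->.
rewrite big_map big_enum /=; apply: eq_bigr => k _; rewrite setTI.
apply: EFin_inj; rewrite -prE // -(X_poisson (fun x => k x)).
congr (P _); apply/seteqP; split => omega /=; first by move=> -> x; rewrite ffunE.
by move=> h; apply/ffunP => x; rewrite ffunE.
Qed.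

Definition dense (s : config n) : Prop :=
  (forall x, s x != None) /\ zeta * n%:R / 4 <= (walks s)%:R.

Let pmf_half L : \sum_(j < L) (poisson_pmf zeta j * 2^-1 ^+ j) <= expR (- (zeta / 2)).
Proof.
have -> : \sum_(j < L) (poisson_pmf zeta j * 2^-1 ^+ j) =
    expR (- zeta) * series (exp_coeff (zeta / 2)) L.
  rewrite /series /= big_mkord mulr_sumr; apply: eq_bigr => j _.
  by rewrite /poisson_pmf zeta_gt0 exp_coeffE exprMn; ring.
apply: le_trans (_ : expR (- zeta) * expR (zeta / 2) <= _).
  by rewrite ler_wpM2l ?expR_ge0 // series_exp_coeff_le // ltW // divr_gt0.
by rewrite -expRD ler_expR; lra.
Qed.

Let walks_occupied L (k : {ffun 'I_n -> 'I_L}) : walks (occupied k) = (\sum_x k x)%N.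
Proof. by apply: eq_bigr => x _; rewrite ffunE. Qed.

(** Chernoff's bound with the generating function at 1/2: when the sum S of the k x is below
    [zeta n / 4], [2 ^ S <= expR (zeta n / 4)], while the mean of [2 ^- S] is at most
    [expR (- (zeta n / 2))] by [pmf_half]. *)
Let low_le L : pr P [set omega | X omega \in [seq occupied k |
    k <- enum [pred k : {ffun 'I_n -> 'I_L} | (\sum_x k x)%:R < zeta * n%:R / 4]]] <=
  expR (- (zeta * n%:R / 4)).
Proof.
rewrite pr_occupied /=.
have pmf0 k : 0 <= poisson_pmf zeta k := poisson_pmf_ge0 zeta k.
apply: le_trans (_ : \sum_(k : {ffun 'I_n -> 'I_L}) expR (zeta * n%:R / 4) *
    \prod_x (poisson_pmf zeta (k x) * 2^-1 ^+ (k x)) <= _).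
  rewrite big_mkcond; apply: ler_sum => k _; case: ifP => kl; last first.
    by rewrite mulr_ge0 ?expR_ge0 ?prodr_ge0 // => x _; rewrite mulr_ge0 // exprn_ge0.
  rewrite big_split /= mulrCA ler_peMr ?prodr_ge0 //.
  rewrite prodrXr exprVn ler_pdivlMr ?exprn_gt0 // mul1r.
  apply: le_trans (_ : expR (\sum_x k x)%:R <= _); last by rewrite ler_expR ltW.
  rewrite -[X in expR X]mulr1 expRM_natl lerXn2r ?nnegrE ?expR_ge0 //.
  by apply: le_trans (expR_ge1Dx _).
rewrite -mulr_sumr -(bigA_distr_bigA (fun (x : 'I_n) (j : 'I_L) =>
  poisson_pmf zeta j * 2^-1 ^+ j)) /= prodr_const card_ord.
apply: le_trans (_ : expR (zeta * n%:R / 4) * expR (- (zeta / 2)) ^+ n <= _).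
  rewrite ler_wpM2l ?expR_ge0 // lerXn2r ?nnegrE ?expR_ge0 ?pmf_half //.
  by apply: sumr_ge0 => j _; rewrite mulr_ge0 // exprn_ge0.
by rewrite -expRM_natl -expRD ler_expR; lra.
Qed.

Lemma pr_dense_start : measurable [set omega | dense (X omega)] ->
  1 - expR (- (zeta * n%:R / 4)) <= pr P [set omega | dense (X omega)].
Proof.
move=> mG; rewrite lerBlDr.
(* The left side is the probability of fewer than L walks on every site; such a configuration is
   either dense or covered by [low_le]. It tends to 1 as L grows. *)
have H L : (expR (- zeta) * series (exp_coeff zeta) L) ^+ n <=
    pr P [set omega | dense (X omega)] + expR (- (zeta * n%:R / 4)).
  have -> : (expR (- zeta) * series (exp_coeff zeta) L) ^+ n =
      pr P [set omega | X omega \in [seq occupied k | k <- enum {: {ffun 'I_n -> 'I_L}}]].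
    rewrite pr_occupied -(bigA_distr_bigA (fun (x : 'I_n) (j : 'I_L) =>
      poisson_pmf zeta j)) /= prodr_const card_ord; congr (_ ^+ _).
    rewrite /series /= big_mkord mulr_sumr; apply: eq_bigr => j _.
    by rewrite /poisson_pmf zeta_gt0 exp_coeffE; ring.
  apply: le_trans (lerD (lexx _) (low_le L)).
  apply: le_trans (pr_setU_le P mG (measurable_mem_seq _ mX)).
  apply: pr_le; first exact: measurable_mem_seq.
    by apply: measurableU => //; exact: measurable_mem_seq.
  move=> omega /= /mapP[k _ ->].
  have [kl|kl] := ltrP (\sum_x k x)%:R (zeta * n%:R / 4); [right|left].
    by apply/mapP; exists k => //; rewrite mem_enum.
  by split=> [x|]; rewrite ?ffunE // walks_occupied.
have cv : (expR (- zeta) * series (exp_coeff zeta) L) ^+ n @[L --> \oo] --> (1 : R).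
  have -> : (1 : R) = (expR (- zeta) * expR zeta) ^+ n.
    by rewrite -expRD addNr expR0 expr1n.
  apply: (@continuous_cvg _ _ _ _ _ (fun L => expR (- zeta) * series (exp_coeff zeta) L)
    (fun x => x ^+ n)); first exact: exprn_continuous.
  by apply: cvgMl_tmp; exact: is_cvg_series_exp_coeff.
by apply: (cvgr_to_le cv); near=> L; exact: H.
Unshelve. all: by end_near.
Qed.

End PoissonStart.

(** * The theorem *)

Section Absorption.
Context (R : realType) d (Omega : measurableType d) (P : probability Omega R).
Variables (n : nat) (lambda zeta : R).
Variables (Y : nat -> Omega -> config n) (W : nat -> Omega -> \bar R).
Hypothesis n_gt0 : (0 < n)%N.
Hypothesis lambda_gt0 : 0 < lambda.
Hypothesis zeta_large : 6 * expR 1 * Num.sqrt lambda < zeta.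
Hypothesis YW : jump_skeleton P (@total_rate R lambda n) (@next_prob R lambda n) Y W.

Let zeta_gt0 : 0 < zeta.
Proof.
by apply: le_lt_trans zeta_large; rewrite !mulr_ge0 ?expR_ge0 ?sqrtr_ge0.
Qed.

Lemma inactive_asleep_on (s : config n) :
  total_active s = 0%N -> exists A : {set 'I_n}, s = asleep_on A.
Proof.
move=> /eqP; rewrite sum_nat_eq0 => /forallP s0.
exists [set x | s x == None]%SET; apply/ffunP => x; rewrite ffunE inE.
by have := s0 x; case: (s x) => [k|] //= /eqP ->.
Qed.

(** Given a dense start, an inactive state is [asleep_on A] for some A. The union bound runs over
    the A with as many sites as there are walks, the others being unreachable by conservation. *)
Lemma pr_absorbed_le (j : nat) :
  pr P [set omega | dense zeta (Y 0%N omega) /\ total_active (Y j omega) = 0%N] <=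
  (1 + j%:R * (1 + (2 * lambda)^-1)) * expR (- (zeta * n%:R / 4)).
Proof.
set c := 1 + _; have c0 : 0 <= c.
  by rewrite addr_ge0 ?mulr_ge0 ?addr_ge0 ?invr_ge0 ?mulr_ge0 // ltW.
have mS (B : set (config n)) k : measurable [set omega | B (Y k omega)].
  exact: measurable_state YW B k.
have mY k s : measurable [set omega | Y k omega = s] := jump_measurable_state YW k s.
have mE : measurable
    [set omega | dense zeta (Y 0%N omega) /\ total_active (Y j omega) = 0%N].
  exact: measurableI (mS (dense zeta) 0%N) (mS (fun s => total_active s = 0%N) j).
apply: (pr_partition_le (X := Y 0%N)) => // [s0|]; last by rewrite mulr_ge0 ?expR_ge0.
have [[as0 ws0]|ns0] := pselect (dense zeta s0); last first.
  rewrite (_ : _ `&` _ = set0) ?pr_set0 ?mulr_ge0 ?pr_ge0 ?expR_ge0 //.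
  by apply/seteqP; split => x // [[+ _] /= e]; rewrite e.
apply: (@le_trans _ _ (\sum_(A : {set 'I_n})
    pr P ([set omega | Y 0%N omega = s0] `&` [set omega | Y j omega = asleep_on A]))).
  apply: pr_le_sum; [exact: measurableI|by move=> A; exact: measurableI|].
  move=> x [[_ /inactive_asleep_on[A YA]] Y0]; exists A => //.
have w0 : (0 < walks s0)%N.
  by rewrite -(ltr0n R); apply: lt_le_trans ws0; rewrite divr_gt0 ?mulr_gt0 ?ltr0n.
apply: (@le_trans _ _ (\sum_(A : {set 'I_n} | walks s0 == #|A|)
    pr P [set omega | Y 0%N omega = s0] *
    (c * \prod_(x in A) (2 * lambda * (gap A x)%:R)))).
  rewrite [leRHS]big_mkcond; apply: ler_sum => A _.
  apply: le_trans (pr_hit YW (succ := @successors n)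
    (h := fun k s => settle_prob lambda A k (wake A s)) (a := asleep_on A) j
    _ _ _ _ _ s0) _.
  - by move=> s; exact: undup_uniq.
  - exact: sum_next_prob1.
  - by move=> k s; exact: settle_prob_ge0.
  - rewrite (_ : wake A _ = asleep_on A) ?settle_prob_asleep_on //.
    by apply/ffunP => x; rewrite !ffunE; case: (boolP (x \in A)).
  - by move=> k s; exact: next_settle_prob.
  have -> : wake A s0 = s0.
    by apply/ffunP => x; rewrite ffunE (negbTE (as0 x)) andbF.
  case: ifP => [wA|/negbT wA]; last by rewrite settle_prob_walks // mulr0.
  rewrite ler_wpM2l ?pr_ge0 //.
  have A0 : (0 < #|A|)%N by rewrite -(eqP wA).
  by have := settle_prob_le_prod_gap j lambda_gt0 A0 as0; rewrite wA mulr1.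
rewrite -!mulr_sumr [leRHS]mulrC ler_wpM2l ?pr_ge0 // ler_wpM2l //.
apply: le_trans (sum_prod_gap_le lambda_gt0 zeta_large w0 n_gt0 ws0) _.
by rewrite ler_expR lerN2.
Qed.

End Absorption.

(* Here [E = expR (c * n)] with [c = zeta / 32], so that the error
   [expR (- (zeta * n / 4))] is [E ^- 8]. *)
Lemma error_terms_le (R : realFieldType) (a q E B : R) :
  0 < q <= 1 -> 0 <= a -> B = 100 * (1 + a) / q ^+ 2 -> B + 2 <= E -> 1 <= E ->
  forall M K : R, 1 <= M -> M <= 2 * E -> 1 <= K -> K <= 5 * M / q ->
  E^-1 ^+ 8 + K * ((1 + K * a) * E^-1 ^+ 8) + E^-1 ^+ 2 <= E^-1.
Proof.
move=> /andP[q0 q1] a0 hB hE E1 M K M1 ME K1 KM.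
have E0 : 0 < E by rewrite (lt_le_trans _ E1).
have B0 : 0 <= B by rewrite hB divr_ge0 ?mulr_ge0 ?addr_ge0 ?exprn_ge0 // ltW.
have K0 : 0 <= K by apply: le_trans K1.
have KE : K <= 10 * E / q.
  by apply: le_trans KM _; rewrite ler_pM2r ?invr_gt0 //; lra.
have h1 : K * (1 + K * a) <= B * E ^+ 2.
  apply: le_trans (_ : K ^+ 2 * (1 + a) <= _); first by nra.
  rewrite hB (_ : _ * E ^+ 2 = (10 * E / q) ^+ 2 * (1 + a)).
    by rewrite ler_wpM2r ?addr_ge0 // lerXn2r ?nnegrE // divr_ge0 ?mulr_ge0 // ltW.
  by field; rewrite gt_eqF.
set e := E^-1; have e0 : 0 < e by rewrite invr_gt0.
have eE : e * E = 1 by rewrite mulVf ?gt_eqF.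
have e1 : e <= 1 by rewrite invf_le1.
have p8 : e ^+ 8 <= e ^+ 2 by rewrite ler_wiXn2l // ltW.
have p82 : e ^+ 8 * E ^+ 2 <= e ^+ 2.
  rewrite (_ : e ^+ 8 * E ^+ 2 = e ^+ 6 * (e * E) ^+ 2); last by ring.
  by rewrite eE expr1n mulr1 ler_wiXn2l // ltW.
have : K * ((1 + K * a) * e ^+ 8) <= B * e ^+ 2.
  rewrite mulrA; apply: le_trans (_ : B * E ^+ 2 * e ^+ 8 <= _).
    by rewrite ler_wpM2r // exprn_ge0 // ltW.
  by rewrite -mulrA ler_wpM2l // mulrC.
have : (B + 2) * e ^+ 2 <= E * e ^+ 2 by rewrite ler_wpM2r // exprn_ge0 // ltW.
rewrite (_ : E * e ^+ 2 = e); last by rewrite expr2 mulrA [E * e]mulrC eE mul1r.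
lra.
Qed.

Theorem theorem6 (R : realType) :
  exists C : R, 0 < C /\
  forall lambda zeta : R, 0 < lambda -> C * Num.sqrt lambda < zeta ->
  exists c : R, 0 < c /\
  exists N : nat, forall n : nat, (N <= n)%N ->
  forall (d : measure_display) (Omega : measurableType d)
    (P : probability Omega R) (eta : R -> Omega -> config n),
    arw_process P lambda eta ->
    iid_poisson P zeta (eta 0) ->
    ((1 - expR (- (c * n%:R)))%:E <=
     P [set omega | (expR (c * n%:R))%:E <= total_activity eta omega])%E.
Proof.
exists (6 * expR 1); split; first by rewrite mulr_gt0 ?expR_gt0.
move=> lambda zeta l0 lz.
have z0 : 0 < zeta.
  by apply: le_lt_trans lz; rewrite !mulr_ge0 ?expR_ge0 ?sqrtr_ge0.
pose c := zeta / 32; have c0 : 0 < c by rewrite divr_gt0.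
exists c; split=> //.
(* [q] will be the probability that a ring is marked, and [a] is the cost factor of one toppling in
   [pr_absorbed_le]. *)
pose q := expR (- (1 + lambda)); pose a := 1 + (2 * lambda)^-1.
have q0 : 0 < q by exact: expR_gt0.
have q1 : q <= 1 by rewrite -expR0 ler_expR; lra.
have a0 : 0 <= a by rewrite addr_ge0 // invr_ge0 mulr_ge0 // ltW.
pose B := 100 * (1 + a) / q ^+ 2.
have B0 : 0 <= B by apply: divr_ge0; [lra | rewrite exprn_ge0 // ltW].
(* This threshold ensures [c n >= B + 1], hence [E >= 1 + c n >= B + 2] as [error_terms_le]
   requires. *)
exists (Num.truncn ((B + 1) / c)).+1 => n hn d Omega P eta [Y [W [YW etaE]]] poi.
have n0 : (0 < n)%N by apply: leq_trans hn.
have cn : B + 1 <= c * n%:R.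
  rewrite mulrC -ler_pdivrMr // ltW // (lt_le_trans (truncnS_gt _)) //.
  by rewrite ler_nat.
set E := expR (c * n%:R).
have BE : B + 2 <= E by apply: le_trans (expR_ge1Dx _); lra.
have E1 : 1 <= E by lra.
pose M := (Num.truncn E).+1.
have ME : E < M%:R by exact: truncnS_gt.
have ME2 : M%:R <= 2 * E.
  rewrite /M -natr1; have /andP[] := truncn_itv (le_trans ler01 E1).
  set v := (Num.truncn E)%:R => vE _; lra.
(* With [q K > 4 M], the bound [2 ^+ M * (1 - q / 2) ^+ K] is at most
   [expR (M - q K / 2) <= expR (- M)]. *)
pose K := (Num.truncn (4 * M%:R / q)).+1.
have M1 : 1 <= M%:R :> R by rewrite ler1n.
have K1 : 1 <= K%:R :> R by rewrite ler1n.
have q4 : 0 <= 4 * M%:R / q by rewrite divr_ge0 ?mulr_ge0 // ltW.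
have KM : 4 * M%:R / q < K%:R by exact: truncnS_gt.
have KM5 : K%:R <= 5 * M%:R / q.
  have h : 1 <= M%:R / q by rewrite ler_pdivlMr // mul1r (le_trans q1).
  rewrite /K -natr1; have /andP[] := truncn_itv q4.
  set v := (Num.truncn _)%:R => vE _; apply: le_trans (lerD vE h) _.
  by rewrite -!mulrA; set x := M%:R / q; lra.
have Y0 : Y 0%N = eta 0.
  apply/funext => omega; have [k [/andP[rk _] ->]] := etaE 0 omega (lexx 0).
  case: k rk => // k; rewrite leNgt => /negP[]; rewrite -[ring_time _ _ _]/(jump_time (W ^~ omega) k.+1).
  have w_gt0 j : (0 < W j omega)%E := jump_wait_gt0 YW j omega.
  apply: (@lt_le_trans _ _ (jump_time (W ^~ omega) 1)).
    by rewrite /jump_time big_ord1.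
  exact: jump_time_le.
have mS (A : set (config n)) k : measurable [set omega | A (Y k omega)].
  exact: measurable_state YW A k.
(* At this threshold the rate times the wait is [1 + lambda] in every active state, so the chance q
   of a mark does not depend on the state. *)
pose ts (s : config n) : R := (total_active s)%:R^-1.
pose good : pred (config n) := fun s => (0 < total_active s)%N.
pose few := few_marks Y W good ts K M.
have mfew : measurable few by exact: measurable_few_marks YW good ts K M.
have mT := measurable_total_activity YW etaE E%:E.
set G := [set omega | (E%:E <= total_activity eta omega)%E] in mT *.
have rateE s : total_rate lambda s = (1 + lambda) * (total_active s)%:R.
  by rewrite /total_rate -mulr_sumr natr_sum.
have pr_few : pr P few <= E^-1 ^+ 2.
  apply: le_trans (_ : 2 ^+ M * (1 - q / 2) ^+ K <= _).
    apply: (pr_few_marks YW) => //.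
    - by move=> s; rewrite invr_ge0.
    - by rewrite q1 ltW.
    - move=> s gs; rewrite rateE -mulrA mulfV ?mulr1 //.
      by rewrite pnatr_eq0 -lt0n.
    - exact: next_prob_ge0.
  apply: le_trans (_ : expR M%:R * expR (- (2 * M%:R)) <= _).
    apply: ler_pM; rewrite ?exprn_ge0 //; first lra.
      rewrite -[X in expR X]mulr1 expRM_natl lerXn2r ?nnegrE ?expR_ge0 //.
      exact: expR_ge1Dx.
    apply: le_trans (_ : expR (- (q / 2)) ^+ K <= _).
      rewrite lerXn2r ?nnegrE ?expR_ge0 //; first lra.
      by apply: le_trans (expR_ge1Dx _).
    rewrite -expRM_natl ler_expR; move: KM; rewrite ltr_pdivrMr //; lra.
  rewrite -expRD /E -expRN -expRM_natl ler_expR.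
  (* From [(1 + y) ^ 2 >= 4 y] at [y = c n / 2]. Then [M > E >= 2 c n] gives
     [expR (- M) <= E ^- 2]. *)
  have : 2 * (c * n%:R) <= E.
    have h := expR_ge1Dx (c * n%:R / 2).
    have -> : E = expR (c * n%:R / 2) ^+ 2 by rewrite -expRM_natl mulrC divfK.
    apply: le_trans (_ : (1 + c * n%:R / 2) ^+ 2 <= _).
      by have := sqr_ge0 (1 - c * n%:R / 2); lra.
    by rewrite lerXn2r ?nnegrE ?expR_ge0 // addr_ge0 // divr_ge0 // mulr_ge0 // ltW.
  move: ME; lra.
have e8 : expR (- (zeta * n%:R / 4)) = E^-1 ^+ 8.
  by rewrite /E -expRN -expRM_natl; congr expR; rewrite /c; field.
pose D := [set omega | dense zeta (Y 0%N omega)].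
have mD : measurable D by exact: mS (dense zeta) 0%N.
have pr_D : 1 - E^-1 ^+ 8 <= pr P D.
  rewrite -e8; apply: (pr_dense_start z0 _ _ mD); last by rewrite Y0.
  exact: jump_measurable_state YW 0%N.
pose absorbed j := [set omega | dense zeta (Y 0%N omega) /\ total_active (Y j omega) = 0%N].
have mabs j : measurable (absorbed j).
  exact: measurableI (mS (dense zeta) 0%N) (mS (fun s => total_active s = 0%N) j).
have pr_abs j : (j < K)%N -> pr P (absorbed j) <= (1 + K%:R * a) * E^-1 ^+ 8.
  move=> jK; apply: le_trans (pr_absorbed_le n0 l0 lz YW j) _.
  rewrite e8 ler_wpM2r ?exprn_ge0 ?invr_ge0 ?expR_ge0 // lerD2l ler_wpM2r //.
  by rewrite ler_nat ltnW.
(* Outside the bad events each of the first K rings finds an active walk and at least M of them are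
   marked, so the activity is at least [M > E]. *)
have cover omega : dense zeta (Y 0%N omega) -> ~ few omega ->
    (forall j, (j < K)%N -> ~ absorbed j omega) -> G omega.
  move=> dn nf na; have pos i : (i < K)%N -> (0 < total_active (Y i omega))%N.
    by move=> iK; rewrite lt0n; apply/eqP => e; apply: (na i iK).
  have := total_activity_ge_marks YW etaE pos; rewrite /G /=.
  apply: le_trans; rewrite lee_fin; apply: (le_trans (ltW ME)); rewrite ler_nat.
  by rewrite leqNgt; apply/negP => lM; apply: nf.
pose ever := [set omega | exists j : 'I_K, absorbed j omega].
have mever : measurable ever by exact: measurable_exists.
have pr_ever : pr P ever <= K%:R * ((1 + K%:R * a) * E^-1 ^+ 8).
  apply: (@le_trans _ _ (\sum_(j < K) pr P (absorbed j))).
    by apply: pr_le_sum => // omega [j ?]; exists j.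
  apply: le_trans (_ : \sum_(j < K) (1 + K%:R * a) * E^-1 ^+ 8 <= _).
    by apply: ler_sum => j _; exact: pr_abs.
  by rewrite sumr_const card_ord -[leLHS]mulr_natl.
have DG : D `<=` G `|` (few `|` ever).
  move=> omega dn; have [nf|nf] := pselect (few omega); first by right; left.
  have [na|na] := pselect (ever omega); first by right; right.
  by left; apply: cover => // j jK aj; apply: na; exists (Ordinal jK).
have mfe : measurable (few `|` ever) by exact: measurableU.
have h := pr_le P mD (measurableU _ _ mT mfe) DG.
have h1 := pr_setU_le P mT mfe; have h2 := pr_setU_le P mfew mever.
have q01 : 0 < q <= 1 by rewrite q0.
have := error_terms_le q01 a0 (erefl B) BE E1 M1 ME2 K1 KM5.
rewrite prE // lee_fin expRN -/E; lra.
Qed.
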